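(* Let $k$ be a field, let $Q$ be a weighted quiver, and let $I$ be a finitely generated homogeneous (two-sided) ideal in the $\mathbb{N}$-graded path algebra $kQ$. Then there exist a finite quiver $Q'$ with all arrows having degree $1$, a finitely generated homogeneous (two-sided) ideal $I' \subset kQ'$, and an equivalence of categories $$F: \operatorname{QGr} kQ/I \to \operatorname{QGr} kQ'/I'$$ which respects shifting, that is, $F(\mathscr{M}(1)) \cong F(\mathscr{M})(1)$ for all $\mathscr{M} \in \operatorname{QGr} kQ/I$.
   Context: A quiver $Q=(Q_0,Q_1,s,t)$ is a finite directed graph with finite vertex set $Q_0$, finite arrow set $Q_1$, and source and target maps $s,t:Q_1\to Q_0$ (loops and multiple arrows are allowed). The path algebra $kQ$ has as $k$-basis all paths in $Q$, including a trivial path $e_v$ at each vertex $v$. The product of paths $p=a_1\cdots a_n$ and $q=b_1\cdots b_m$ is $a_1\cdots a_nb_1\cdots b_m$ if $t(a_n)=s(b_1)$ and zero otherwise. A weighted quiver is a pair $(Q,\deg)$ (written just $Q$) with $Q$ a finite quiver and $\deg:Q_1\to\mathbb{N}_{>0}$ a function. It makes $kQ$ an $\mathbb{N}$-graded algebra in which each arrow $a$ has degree $\deg(a)$ and the trivial paths have degree $0$. In particular, $kQ'$ above is graded with every arrow in degree $1$. For an $\mathbb{N}$-graded $k$-algebra $A$, $\operatorname{Gr} A$ denotes the category of $\mathbb{Z}$-graded right $A$-modules with degree-preserving homomorphisms; $\operatorname{Fdim} A$ is the full (localizing) subcategory of graded modules that are the sum of their finite-dimensional submodules; and $\operatorname{QGr}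 A$ is the quotient category $\operatorname{Gr} A/\operatorname{Fdim} A$. The shift $M(1)$ of a graded module $M$ is given by $M(1)_i=M_{i+1}$; this induces the shift $\mathscr{M}\mapsto\mathscr{M}(1)$ on $\operatorname{QGr} A$. *)

(* Defs.v *)
From HB Require Import structures.
From mathcomp Require Import all_boot all_algebra finmap boolp.
From mathcomp.multinomials Require Import monalg.

Set Implicit Arguments.
Unset Strict Implicit.
Unset Printing Implicit Defensive.

Import GRing.Theory.

Local Open Scope ring_scope.

Record grading (D : eqType) (V : zmodType) (C : D -> V -> Prop) : Prop :=
  Grading {
    grading0 : forall d, C d 0;
    gradingB : forall d x y, C d x -> C d y -> C d (x - y);
    grading_sum : forall x, exists (s : seq D) (f : D -> V),
      [/\ uniq s, forall d, C d (f d) & x = \sum_(d <- s) f d];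
    grading_free : forall (s : seq D) (f : D -> V),
      uniq s -> (forall d, C d (f d)) -> \sum_(d <- s) f d = 0 ->
      forall d, d \in s -> f d = 0
  }.

Definition homogeneous (D : eqType) (V : zmodType) (C : D -> V -> Prop)
    (X : V -> Prop) : Prop :=
  forall (s : seq D) (f : D -> V),
    uniq s -> (forall d, C d (f d)) -> X (\sum_(d <- s) f d) ->
    forall d, d \in s -> X (f d).

(* The zero algebra is allowed (it is k Q for the empty quiver, or k Q / I for
   I = k Q), so that MathComp's algType, which is nontrivial, is not usable:
   the k-algebra structure is given by a central morphism from k. *)

Record gradedAlg (k : fieldType) := GradedAlg {
  galg_ring :> pzRingType;
  galg_in : {rmorphism k -> galg_ring};
  galg_inC : forall c x, galg_in c * x = x * galg_in c;
  galg_comp : nat -> galg_ring -> Prop;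
  galg_grading : grading galg_comp;
  galg_comp_in : forall c, galg_comp 0 (galg_in c);
  galg_compM : forall m n x y,
    galg_comp m x -> galg_comp n y -> galg_comp (m + n)%N (x * y)
}.

Record ideal (R : pzRingType) := Ideal {
  ideal_mem :> R -> Prop;
  ideal0 : ideal_mem 0;
  idealB : forall x y, ideal_mem x -> ideal_mem y -> ideal_mem (x - y);
  idealMl : forall a x, ideal_mem x -> ideal_mem (a * x);
  idealMr : forall a x, ideal_mem x -> ideal_mem (x * a)
}.

Definition finitely_generated (R : pzRingType) (I : ideal R) : Prop :=
  exists s : seq R, forall x,
    I x <-> (forall J : ideal R, (forall y, y \in s -> J y) -> J x).

Definition homogeneous_ideal (k : fieldType) (A : gradedAlg k)
  (I : ideal A) : Prop := homogeneous (@galg_comp k A) I.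

Section IdealQuotient.
Variables (R : pzRingType) (I : ideal R).

Definition ideal_pred : {pred R} := fun x => `[< I x >].

Fact ideal_pred_closed : zmod_closed ideal_pred.
Proof.
split=> [|x y]; first by apply/asboolP; apply: ideal0.
by move=> /asboolP Ix /asboolP Iy; apply/asboolP; apply: idealB.
Qed.

HB.instance Definition _ := GRing.isZmodClosed.Build R ideal_pred
  ideal_pred_closed.

Definition idealQuot : Type := Quotient.quot ideal_pred.

HB.instance Definition _ := GRing.Zmodule.on idealQuot.

Definition iproj (x : R) : idealQuot := \pi_(Quotient.quot ideal_pred)%qT x.

Lemma iprojP x y : iproj x = iproj y <-> I (x - y).
Proof.
split=> [/eqP|Ixy]; last apply/eqP.
  by rewrite -Quotient.idealrBE => /asboolP.
by rewrite -Quotient.idealrBE; apply/asboolP.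
Qed.

Lemma iproj_surj (u : idealQuot) : exists x, u = iproj x.
Proof. by exists (repr u); rewrite /iproj reprK. Qed.

Fact iproj_additive : zmod_morphism iproj.
Proof. by move=> x y; rewrite /iproj raddfB. Qed.

HB.instance Definition _ :=
  GRing.isZmodMorphism.Build R idealQuot iproj iproj_additive.

Definition iquot_mul (u v : idealQuot) : idealQuot :=
  iproj (repr u * repr v).

Lemma iprojM x y : iproj (x * y) = iquot_mul (iproj x) (iproj y).
Proof.
apply/iprojP; set x' := repr _; set y' := repr _.
have Ix : I (x - x') by apply/iprojP; rewrite /x' /iproj reprK.
have Iy : I (y - y') by apply/iprojP; rewrite /y' /iproj reprK.
have -> : x * y - x' * y' = (x - x') * y - - (x' * (y - y')).
  by rewrite mulrBl mulrBr opprK addrA subrK.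
apply: idealB; first exact: idealMr.
rewrite -mulrN; apply: idealMl; rewrite -[X in I X]sub0r.
by apply: idealB => //; apply: ideal0.
Qed.

Fact iquot_mulA : associative iquot_mul.
Proof.
move=> u v w; have [x ->] := iproj_surj u; have [y ->] := iproj_surj v.
by have [z ->] := iproj_surj w; rewrite -!iprojM mulrA.
Qed.

Fact iquot_mul1 : left_id (iproj 1) iquot_mul.
Proof. by move=> u; have [x ->] := iproj_surj u; rewrite -iprojM mul1r. Qed.

Fact iquot_mulr1 : right_id (iproj 1) iquot_mul.
Proof. by move=> u; have [x ->] := iproj_surj u; rewrite -iprojM mulr1. Qed.

Fact iquot_mulDl : left_distributive iquot_mul +%R.
Proof.
move=> u v w; have [x ->] := iproj_surj u; have [y ->] := iproj_surj v.
by have [z ->] := iproj_surj w; rewrite -raddfD -!iprojM -raddfD mulrDl.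
Qed.

Fact iquot_mulDr : right_distributive iquot_mul +%R.
Proof.
move=> u v w; have [x ->] := iproj_surj u; have [y ->] := iproj_surj v.
by have [z ->] := iproj_surj w; rewrite -raddfD -!iprojM -raddfD mulrDr.
Qed.

HB.instance Definition _ := GRing.Zmodule_isPzRing.Build idealQuot
  iquot_mulA iquot_mul1 iquot_mulr1 iquot_mulDl iquot_mulDr.

Fact iproj_monoid : monoid_morphism iproj.
Proof. by split=> // x y; apply: iprojM. Qed.

HB.instance Definition _ :=
  GRing.isMonoidMorphism.Build R idealQuot iproj iproj_monoid.

End IdealQuotient.

Section QuotAlg.
Variables (k : fieldType) (A : gradedAlg k) (I : ideal A).
Hypothesis homI : homogeneous_ideal I.

Local Notation proj := (@iproj A I).

Definition quot_comp (n : nat) (u : idealQuot I) : Prop :=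
  exists2 x, galg_comp n x & u = proj x.

Fact quot_grading : grading quot_comp.
Proof.
have gA := galg_grading A; split.
- by move=> n; exists 0; [apply: (grading0 gA) | rewrite raddf0].
- move=> n _ _ [x Ax ->] [y Ay ->]; exists (x - y); last by rewrite raddfB.
  exact: (gradingB gA).
- move=> u; have [x ->] := iproj_surj u.
  have [s [f [us Af ->]]] := grading_sum gA x.
  exists s, (fun n => proj (f n)); split=> [//|n|]; last by rewrite raddf_sum.
  by exists (f n).
move=> s f us Af f0 n ns.
pose P n x := galg_comp n x /\ f n = proj x.
have /choice[g gP] : forall n, exists x, P n x.
  by move=> m; have [x Ax fx] := Af m; exists x.
have Ig : I (\sum_(d <- s) g d).
  rewrite -[X in I X]subr0; apply/iprojP; rewrite raddf0 raddf_sum -[RHS]f0.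
  by apply: eq_bigr => d _; have [_ ->] := gP d.
have [_ ->] := gP n; rewrite -(raddf0 proj); apply/iprojP; rewrite subr0.
by apply: (homI us _ Ig ns) => d; have [] := gP d.
Qed.

Fact quot_inC c (u : idealQuot I) :
  (proj \o galg_in A) c * u = u * (proj \o galg_in A) c.
Proof.
by have [x ->] := iproj_surj u; rewrite /= -!rmorphM galg_inC.
Qed.

Fact quot_comp_in c : quot_comp 0 ((proj \o galg_in A) c).
Proof. by exists (galg_in A c); first exact: galg_comp_in. Qed.

Fact quot_compM m n u v :
  quot_comp m u -> quot_comp n v -> quot_comp (m + n)%N (u * v).
Proof.
move=> [x Ax ->] [y Ay ->]; exists (x * y); last by rewrite rmorphM.
exact: galg_compM.
Qed.

Definition quotAlg : gradedAlg k :=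
  GradedAlg quot_inC quot_grading quot_comp_in quot_compM.

End QuotAlg.

Record wquiver := WQuiver {
  vertex : finType;
  arrow : finType;
  src : arrow -> vertex;
  tgt : arrow -> vertex;
  deg : arrow -> nat;
  deg_gt0 : forall a, (0 < deg a)%N
}.

Section Paths.
Variable Q : wquiver.

Fixpoint composable (v : vertex Q) (s : seq (arrow Q)) : bool :=
  if s is a :: s' then (src a == v) && composable (tgt a) s' else true.

(* A path is its starting vertex together with its list of arrows; the pair
   (v, [::]) is the trivial path e_v. *)
Record qpath := QPath {
  qpath_val :> vertex Q * seq (arrow Q);
  _ : composable qpath_val.1 qpath_val.2
}.

HB.instance Definition _ := [isSub for qpath_val].
HB.instance Definition _ := [Choice of qpath by <:].

Definition path_src (p : qpath) : vertex Q := (val p).1.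
Definition path_arrows (p : qpath) : seq (arrow Q) := (val p).2.
Definition path_tgt (p : qpath) : vertex Q :=
  last (path_src p) (map (@tgt Q) (path_arrows p)).
Definition path_deg (p : qpath) : nat :=
  \sum_(a <- path_arrows p) deg a.

Definition triv_path (v : vertex Q) : qpath :=
  @QPath (v, [::]) isT.

Lemma composable_cat v s1 s2 : composable v (s1 ++ s2) =
  composable v s1 && composable (last v (map (@tgt Q) s1)) s2.
Proof. by elim: s1 v => //= a s1 IHs v; rewrite IHs andbA. Qed.

Fact composable_concat (p q : qpath) : path_tgt p = path_src q ->
  composable (path_src p) (path_arrows p ++ path_arrows q).
Proof.
case: p q => [[v s] /= vs] [[w t] /= wt] /= e.
by rewrite composable_cat vs; move: e; rewrite /path_tgt /path_src /= => ->.
Qed.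

Definition path_mul (p q : qpath) : option qpath :=
  if path_tgt p =P path_src q is ReflectT e then
    Some (@QPath (path_src p, path_arrows p ++ path_arrows q)
                 (composable_concat e))
  else None.

Variant path_mul_spec (p q : qpath) : option qpath -> Prop :=
| PathMulSome r of path_tgt p = path_src q & path_src r = path_src p
    & path_tgt r = path_tgt q
    & path_arrows r = path_arrows p ++ path_arrows q :
    path_mul_spec p q (Some r)
| PathMulNone of path_tgt p <> path_src q : path_mul_spec p q None.

Lemma path_mulP p q : path_mul_spec p q (path_mul p q).
Proof.
rewrite /path_mul; case: eqP => e; constructor=> //.
by rewrite /path_tgt /= map_cat last_cat [last _ (map _ (path_arrows p))]e.
Qed.

Lemma qpath_eq (p q : qpath) :
  path_src p = path_src q -> path_arrows p = path_arrows q -> p = q.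
Proof.
case: p q => [[v s] vs] [[w t] wt]; rewrite /path_src /path_arrows /= => ev es.
by apply: val_inj; rewrite /= ev es.
Qed.

Lemma path_mulA p q r :
  obind (path_mul p) (path_mul q r) = obind (path_mul^~ r) (path_mul p q).
Proof.
case: (path_mulP q r) => [qr e1 s1 t1 a1|e1];
  case: (path_mulP p q) => [pq e2 s2 t2 a2|e2] //=.
- case: path_mulP => [x f1 g1 h1 b1|]; last by rewrite s1.
  case: path_mulP => [y f2 g2 h2 b2|]; last by rewrite t2.
  congr Some; apply: qpath_eq; first by rewrite g1 g2 s2.
  by rewrite b1 b2 a1 a2 catA.
- by case: path_mulP => // x f; case: e2; rewrite f s1.
by case: path_mulP => // x f; case: e1; rewrite -f t2.
Qed.

Lemma path_mul_trivl v p :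
  path_mul (triv_path v) p = if v == path_src p then Some p else None.
Proof.
case: path_mulP => [r e g _ b|e]; last by case: eqP => // /e.
have -> : v = path_src p by exact: e.
by rewrite eqxx; congr Some; apply: qpath_eq; [rewrite g; exact: e | rewrite b].
Qed.

Lemma path_mul_trivr v p :
  path_mul p (triv_path v) = if v == path_tgt p then Some p else None.
Proof.
case: path_mulP => [r e g _ b|e].
  rewrite e eqxx; congr Some; apply: qpath_eq => //.
  by rewrite b cats0.
by case: eqP => // ev; case: e; rewrite -ev.
Qed.

Lemma path_deg_mul p q r :
  path_mul p q = Some r -> path_deg r = (path_deg p + path_deg q)%N.
Proof.
by case: path_mulP => // x _ _ _ b [<-]; rewrite /path_deg b big_cat.
Qed.

End Paths.

Section PathAlgebra.
Variables (k : fieldType) (Q : wquiver).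

Local Notation P := (qpath Q).

Definition pathRing : Type := {malg k[P]}.

HB.instance Definition _ := GRing.Lmodule.on pathRing.

Definition monom (c : k) (p : option P) : pathRing :=
  if p is Some r then << c *g r >> else 0.

Definition pathRing_mul : pathRing -> pathRing -> pathRing :=
  locked (fun x y =>
    \sum_(p <- msupp x) \sum_(q <- msupp y)
      monom (x@_p * y@_q) (path_mul p q)).

(* The unit of k Q is the sum of the trivial paths, so this is c%:A. *)
Definition pathRing_in (c : k) : pathRing :=
  \sum_v << c *g triv_path v >>.

Local Notation mul := pathRing_mul.

Lemma pathRing_mulE x y : mul x y =
  \sum_(p <- msupp x) \sum_(q <- msupp y) monom (x@_p * y@_q) (path_mul p q).
Proof. by rewrite /pathRing_mul -lock. Qed.

Lemma monomD c d p : monom (c + d) p = monom c p + monom d p.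
Proof. by case: p => [p|] /=; rewrite ?addr0 ?monalgUD. Qed.

Lemma monom0 p : monom 0 p = 0.
Proof. by case: p => [p|] //=; rewrite monalgU0. Qed.

Lemma pathRing_mulw (d1 d2 : {fset P}) (x y : pathRing) :
    (msupp x `<=` d1)%fset -> (msupp y `<=` d2)%fset ->
  mul x y = \sum_(p <- d1) \sum_(q <- d2) monom (x@_p * y@_q) (path_mul p q).
Proof.
move=> le1 le2; rewrite pathRing_mulE (big_fset_incl _ le1) /=.
  apply: eq_bigr => p _; apply: big_fset_incl => // q _ /mcoeff_outdom ->.
  by rewrite mulr0 monom0.
by move=> p _ /mcoeff_outdom xp; rewrite big1 // => q _; rewrite xp mul0r monom0.
Qed.

Fact pathRing_mulDl : left_distributive mul +%R.
Proof.
move=> x y z; pose d := (msupp x `|` msupp y)%fset.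
rewrite (@pathRing_mulw d (msupp z)) ?msuppD_le //.
rewrite (@pathRing_mulw d (msupp z)) ?fsubsetUl //.
rewrite (@pathRing_mulw d (msupp z) y) ?fsubsetUr //.
rewrite -big_split /=; apply: eq_bigr => p _.
rewrite -big_split /=; apply: eq_bigr => q _.
by rewrite mcoeffD mulrDl monomD.
Qed.

Fact pathRing_mulDr : right_distributive mul +%R.
Proof.
move=> z x y; pose d := (msupp x `|` msupp y)%fset.
rewrite (@pathRing_mulw (msupp z) d) ?msuppD_le //.
rewrite (@pathRing_mulw (msupp z) d) ?fsubsetUl //.
rewrite (@pathRing_mulw (msupp z) d _ y) ?fsubsetUr //.
rewrite -big_split /=; apply: eq_bigr => p _.
rewrite -big_split /=; apply: eq_bigr => q _.
by rewrite mcoeffD mulrDr monomD.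
Qed.

Lemma pathRing_mulUU c d p q :
  mul << c *g p >> << d *g q >> = monom (c * d) (path_mul p q).
Proof.
rewrite (@pathRing_mulw [fset p]%fset [fset q]%fset) ?msuppU_le //.
by rewrite !big_seq_fset1 !mcoeffUU.
Qed.

Lemma mul0x x : mul 0 x = 0.
Proof. by apply: (addrI (mul 0 x)); rewrite -pathRing_mulDl !addr0. Qed.

Lemma mulx0 x : mul x 0 = 0.
Proof. by apply: (addrI (mul x 0)); rewrite -pathRing_mulDr !addr0. Qed.

Lemma mul_suml (I : Type) (s : seq I) (F : I -> pathRing) y :
  mul (\sum_(i <- s) F i) y = \sum_(i <- s) mul (F i) y.
Proof.
exact: (big_morph (mul^~ y) (fun _ _ => pathRing_mulDl _ _ _) (mul0x y)).
Qed.

Lemma mul_sumr (I : Type) (s : seq I) (F : I -> pathRing) y :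
  mul y (\sum_(i <- s) F i) = \sum_(i <- s) mul y (F i).
Proof.
exact: (big_morph (mul y) (fun _ _ => pathRing_mulDr _ _ _) (mulx0 y)).
Qed.

Lemma pathRing_ext (f g : pathRing -> pathRing) :
    {morph f : x y / x + y} -> {morph g : x y / x + y} ->
    (forall c p, f << c *g p >> = g << c *g p >>) -> f =1 g.
Proof.
move=> fD gD fg x.
have f0 : f 0 = 0 by apply: (addrI (f 0)); rewrite -fD !addr0.
have g0 : g 0 = 0 by apply: (addrI (g 0)); rewrite -gD !addr0.
rewrite (monalgE x) (big_morph f fD f0) (big_morph g gD g0).
exact: eq_bigr.
Qed.

Fact pathRing_mulA : associative mul.
Proof.
have A1 c p d q e r : mul << c *g p >> (mul << d *g q >> << e *g r >>) =
    mul (mul << c *g p >> << d *g q >>) << e *g r >>.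
  have l t : mul << c *g p >> (monom (d * e) t) =
      monom (c * (d * e)) (obind (path_mul p) t).
    by case: t => [t|] /=; [rewrite pathRing_mulUU | rewrite mulx0].
  have h t : mul (monom (c * d) t) << e *g r >> =
      monom (c * d * e) (obind (fun u => path_mul u r) t).
    by case: t => [t|] /=; [rewrite pathRing_mulUU | rewrite mul0x].
  rewrite [X in mul _ X = _]pathRing_mulUU [X in _ = mul X _]pathRing_mulUU.
  by rewrite [LHS]l [RHS]h mulrA path_mulA.
have A2 a b : (forall e r, mul a (mul b << e *g r >>) =
    mul (mul a b) << e *g r >>) -> forall z, mul a (mul b z) = mul (mul a b) z.
  move=> ab; apply: pathRing_ext => [u v|u v|//].
    by rewrite 2!pathRing_mulDr.
  by rewrite pathRing_mulDr.
have A3 a z : (forall d q, mul a (mul << d *g q >> z) =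
    mul (mul a << d *g q >>) z) -> forall y, mul a (mul y z) = mul (mul a y) z.
  move=> az; apply: (pathRing_ext (f := fun y => mul a (mul y z))
    (g := fun y => mul (mul a y) z)) => [u v|u v|//].
    by rewrite pathRing_mulDl pathRing_mulDr.
  by rewrite pathRing_mulDr pathRing_mulDl.
have A4 y z : (forall c p, mul << c *g p >> (mul y z) =
    mul (mul << c *g p >> y) z) -> forall x, mul x (mul y z) = mul (mul x y) z.
  move=> yz; apply: (pathRing_ext (f := fun x => mul x (mul y z))
    (g := fun x => mul (mul x y) z)) => [u v|u v|//].
    by rewrite pathRing_mulDl.
  by rewrite 2!pathRing_mulDl.
move=> x y z; apply: A4 => c p; apply: A3 => d q; apply: A2 => e r.
exact: A1.
Qed.

Lemma scale_monom c d p : c *: (<< d *g p >> : pathRing) = << c * d *g p >>.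
Proof.
apply/malgP => q; rewrite mcoeffZ [X in _ * X = _]mcoeffU [RHS]mcoeffU.
by rewrite mulrnAr.
Qed.

Lemma pathRing_mul_in c x : mul (pathRing_in c) x = c *: x.
Proof.
have A : mul (pathRing_in c) =1 *:%R c; last exact: A.
apply: pathRing_ext => [u v|u v|d p]; first exact: pathRing_mulDr.
  exact: scalerDr.
rewrite mul_suml (bigD1 (path_src p)) //= pathRing_mulUU path_mul_trivl eqxx /=.
rewrite big1 ?addr0 => [|v /negPf nv].
  by rewrite scale_monom.
by rewrite pathRing_mulUU path_mul_trivl nv.
Qed.

Lemma pathRing_mulr_in c x : mul x (pathRing_in c) = c *: x.
Proof.
have A : mul^~ (pathRing_in c) =1 *:%R c; last exact: A.
apply: pathRing_ext => [u v|u v|d p]; first exact: pathRing_mulDl.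
  exact: scalerDr.
rewrite mul_sumr (bigD1 (path_tgt p)) //= pathRing_mulUU path_mul_trivr eqxx /=.
rewrite big1 ?addr0 => [|v /negPf nv].
  by rewrite scale_monom mulrC.
by rewrite pathRing_mulUU path_mul_trivr nv.
Qed.

Fact pathRing_mul1 : left_id (pathRing_in 1) mul.
Proof. by move=> x; rewrite pathRing_mul_in scale1r. Qed.

Fact pathRing_mulr1 : right_id (pathRing_in 1) mul.
Proof. by move=> x; rewrite pathRing_mulr_in scale1r. Qed.

HB.instance Definition _ := GRing.Zmodule_isPzRing.Build pathRing
  pathRing_mulA pathRing_mul1 pathRing_mulr1 pathRing_mulDl pathRing_mulDr.

Fact pathRing_in_additive : zmod_morphism pathRing_in.
Proof.
move=> c d; rewrite /pathRing_in -sumrB; apply: eq_bigr => v _.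
by rewrite monalgUB.
Qed.

HB.instance Definition _ :=
  GRing.isZmodMorphism.Build k pathRing pathRing_in pathRing_in_additive.

Fact pathRing_in_monoid : monoid_morphism pathRing_in.
Proof.
split=> // c d; rewrite [RHS]pathRing_mul_in scaler_sumr; apply: eq_bigr => v _.
by rewrite scale_monom.
Qed.

HB.instance Definition _ :=
  GRing.isMonoidMorphism.Build k pathRing pathRing_in pathRing_in_monoid.

Fact pathRing_inC c (x : pathRing) : pathRing_in c * x = x * pathRing_in c.
Proof. by rewrite [LHS]pathRing_mul_in [RHS]pathRing_mulr_in. Qed.

Definition path_comp (n : nat) (x : pathRing) : Prop :=
  forall p : P, p \in msupp x -> path_deg p = n.

Lemma path_comp_coeff n (x : pathRing) p :
  path_comp n x -> path_deg p <> n -> x@_p = 0.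
Proof. by move=> xn np; case: msuppP => // /xn. Qed.

Fact path_comp0 n : path_comp n 0.
Proof. by move=> p; rewrite msupp0. Qed.

Fact path_compB n x y : path_comp n x -> path_comp n y -> path_comp n (x - y).
Proof.
move=> xn yn p /(fsubsetP (msuppB_le x y)); rewrite in_fsetU.
by case/orP => [/xn|/yn].
Qed.

Fact path_compD n x y : path_comp n x -> path_comp n y -> path_comp n (x + y).
Proof.
move=> xn yn; rewrite -[y]opprK; apply: path_compB => //.
by rewrite -sub0r; apply: path_compB => //; apply: path_comp0.
Qed.

Fact path_comp_sum n (I : eqType) (s : seq I) (F : I -> pathRing) :
  (forall i, i \in s -> path_comp n (F i)) -> path_comp n (\sum_(i <- s) F i).
Proof.
move=> Fn; rewrite big_seq; apply: big_ind => [|x y|i]; last exact: Fn.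
  exact: path_comp0.
exact: path_compD.
Qed.

Lemma path_compU n c p : path_deg p = n -> path_comp n << c *g p >>.
Proof. by move=> pn q /(fsubsetP msuppU_le); rewrite in_fset1 => /eqP ->. Qed.

Fact path_grading : grading path_comp.
Proof.
split; [exact: path_comp0 | exact: path_compB | move=> x | ].
  pose f n : pathRing := \sum_(p <- msupp x | path_deg p == n) << x@_p *g p >>.
  exists (undup (map (@path_deg Q) (msupp x))), f; split.
  - exact: undup_uniq.
  - move=> n; rewrite /f -big_filter; apply: path_comp_sum => p.
    by rewrite mem_filter => /andP[/eqP pn _]; apply: path_compU.
  rewrite /f (exchange_big_dep predT) //= {1}(monalgE x).
  rewrite [LHS]big_seq [RHS]big_seq; apply: eq_bigr => p px.
  rewrite -big_filter (bigD1_seq (path_deg p)) /=.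
  - rewrite big1_seq ?addr0 // => n /andP[/negPf nn].
    by rewrite mem_filter eq_sym nn.
  - by rewrite mem_filter eqxx mem_undup map_f.
  by rewrite filter_uniq ?undup_uniq.
move=> s f us fn f0 n ns; apply/malgP => p; rewrite mcoeff0.
have [pn|pn] := eqVneq (path_deg p) n; last first.
  by apply: path_comp_coeff (fn n) _; apply/eqP.
move/malgP/(_ p): f0; rewrite mcoeff0 raddf_sum /= (bigD1_seq n) //=.
rewrite big1 ?addr0 // => m /negPf mn.
by apply: path_comp_coeff (fn m) _ => pm; rewrite -pn pm eqxx in mn.
Qed.

Fact path_comp_in c : path_comp 0 (pathRing_in c).
Proof.
apply: path_comp_sum => v _; apply: path_compU.
by rewrite /path_deg big_nil.
Qed.

Fact path_compM m n (x y : pathRing) :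
  path_comp m x -> path_comp n y -> path_comp (m + n)%N (x * y).
Proof.
move=> xm yn; rewrite [x * y]pathRing_mulE.
apply: path_comp_sum => p px; apply: path_comp_sum => q qy.
case e: path_mul => [r|] /=; last exact: path_comp0.
by apply: path_compU; rewrite (path_deg_mul e) (xm p) // (yn q).
Qed.

Definition pathAlg : gradedAlg k :=
  GradedAlg pathRing_inC path_grading path_comp_in path_compM.

End PathAlgebra.

(* Equality of morphisms is an explicit equivalence relation heq, so that a
   localization needs no quotient type. *)

Record category := Category {
  ob :> Type;
  hom : ob -> ob -> Type;
  heq : forall x y, hom x y -> hom x y -> Prop;
  idm : forall x, hom x x;
  comp : forall x y z, hom x y -> hom y z -> hom x z;
  heq_refl : forall x y (f : hom x y), heq f f;
  heq_sym : forall x y (f g : hom x y), heq f g -> heq g f;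
  heq_trans : forall x y (f g h : hom x y), heq f g -> heq g h -> heq f h;
  comp_heq : forall x y z (f f' : hom x y) (g g' : hom y z),
    heq f f' -> heq g g' -> heq (comp f g) (comp f' g');
  comp_idl : forall x y (f : hom x y), heq (comp (idm x) f) f;
  comp_idr : forall x y (f : hom x y), heq (comp f (idm y)) f;
  compA : forall x y z t (f : hom x y) (g : hom y z) (h : hom z t),
    heq (comp f (comp g h)) (comp (comp f g) h)
}.

(* comp f g is "f, then g". *)
Arguments idm {c} x.
Arguments comp {c x y z} f g.
Arguments heq {c x y} f g.

Definition is_iso (C : category) (x y : C) (f : hom x y) : Prop :=
  exists g : hom y x, heq (comp f g) (idm x) /\ heq (comp g f) (idm y).

Definition isomorphic (C : category) (x y : C) : Prop :=
  exists f : hom x y, is_iso f.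

Record functor (C D : category) := Functor {
  fob :> C -> D;
  fhom : forall x y, hom x y -> hom (fob x) (fob y);
  fhom_heq : forall x y (f g : hom x y), heq f g -> heq (fhom f) (fhom g);
  fhom_id : forall x, heq (fhom (idm x)) (idm (fob x));
  fhom_comp : forall x y z (f : hom x y) (g : hom y z),
    heq (fhom (comp f g)) (comp (fhom f) (fhom g))
}.

Definition functor_id (C : category) : functor C C :=
  @Functor C C (fun x => x) (fun _ _ f => f) (fun _ _ _ _ e => e)
    (fun x => heq_refl (idm x)) (fun _ _ _ f g => heq_refl (comp f g)).

Section FunctorComp.
Variables (B C D : category) (F : functor B C) (G : functor C D).

Definition functor_comp : functor B D.
Proof.
exists (fun x => G (F x)) (fun x y f => fhom G (fhom F f)).
- by move=> x y f g fg; do 2!apply: fhom_heq.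
- by move=> x; apply: heq_trans (fhom_heq _ (fhom_id _ _)) (fhom_id _ _).
by move=> x y z f g; apply: heq_trans (fhom_heq _ (fhom_comp _ _ _)) (fhom_comp _ _ _).
Defined.

End FunctorComp.

Definition nat_isomorphic (C D : category) (F G : functor C D) : Prop :=
  exists eta : forall x, hom (F x) (G x),
    (forall x, is_iso (eta x)) /\
    (forall x y (f : hom x y),
       heq (comp (fhom F f) (eta y)) (comp (eta x) (fhom G f))).

Definition is_equivalence (C D : category) (F : functor C D) : Prop :=
  exists G : functor D C,
    nat_isomorphic (functor_comp F G) (functor_id C) /\
    nat_isomorphic (functor_comp G F) (functor_id D).

(* The localization C[S^-1] of Gabriel and Zisman: morphisms are formal
   composites of morphisms of C and of formal inverses of morphisms in S,
   modulo the congruence generated by the relations of C and those making the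
   formal inverses two-sided inverses. *)

Section Localization.
Variables (C : category) (S : forall x y : C, hom x y -> Prop).

Inductive lhom : C -> C -> Type :=
| Lof x y of hom x y : lhom x y
| Linv x y (s : hom x y) of S s : lhom y x
| Lcomp x y z of lhom x y & lhom y z : lhom x z.

Inductive lheq : forall x y, lhom x y -> lhom x y -> Prop :=
| lheq_refl x y (f : lhom x y) : lheq f f
| lheq_sym x y (f g : lhom x y) of lheq f g : lheq g f
| lheq_trans x y (f g h : lhom x y) of lheq f g & lheq g h : lheq f h
| lheq_comp x y z (f f' : lhom x y) (g g' : lhom y z) of lheq f f'
    & lheq g g' : lheq (Lcomp f g) (Lcomp f' g')
| lheq_idl x y (f : lhom x y) : lheq (Lcomp (Lof (idm x)) f) f
| lheq_idr x y (f : lhom x y) : lheq (Lcomp f (Lof (idm y))) f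
| lheq_A x y z t (f : lhom x y) (g : lhom y z) (h : lhom z t) :
    lheq (Lcomp f (Lcomp g h)) (Lcomp (Lcomp f g) h)
| lheq_of x y (f g : hom x y) of heq f g : lheq (Lof f) (Lof g)
| lheq_of_comp x y z (f : hom x y) (g : hom y z) :
    lheq (Lof (comp f g)) (Lcomp (Lof f) (Lof g))
| lheq_invr x y (s : hom x y) (Ss : S s) :
    lheq (Lcomp (Lof s) (Linv Ss)) (Lof (idm x))
| lheq_invl x y (s : hom x y) (Ss : S s) :
    lheq (Lcomp (Linv Ss) (Lof s)) (Lof (idm y)).

Definition localization : category :=
  @Category C lhom lheq (fun x => Lof (idm x)) Lcomp
    lheq_refl lheq_sym lheq_trans lheq_comp lheq_idl lheq_idr lheq_A.

End Localization.

Section GradedModules.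
Variables (k : fieldType) (A : gradedAlg k).

(* Right A-modules are left modules over the opposite ring A^c. *)
Record gmod := GMod {
  gmod_car :> lmodType A^c;
  gmod_comp : int -> gmod_car -> Prop;
  gmod_grading : grading gmod_comp;
  gmod_comp_act : forall i n (x : gmod_car) (a : A),
    gmod_comp i x -> galg_comp n a -> gmod_comp (i + n%:Z) ((a : A^c) *: x)
}.

Definition ract (M : gmod) (x : M) (a : A) : M := (a : A^c) *: x.

Definition kscale (M : gmod) (c : k) (x : M) : M := ract x (galg_in A c).

Record ghom (M N : gmod) := GHom {
  ghom_fun :> {linear M -> N};
  ghom_comp : forall i x, gmod_comp i x -> gmod_comp i (ghom_fun x)
}.

Definition gid (M : gmod) : ghom M M :=
  @GHom M M (@idfun M : {linear M -> M}) (fun _ _ h => h).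

Definition gcomp (M N P : gmod) (f : ghom M N) (g : ghom N P) : ghom M P :=
  @GHom M P (g \o f : {linear M -> P})
    (fun _ _ h => ghom_comp g (ghom_comp f h)).

Definition Gr : category.
Proof.
exists gmod ghom (fun M N f g => f =1 g) gid gcomp => //.
- by move=> M N f g fg x; rewrite fg.
- by move=> M N f g h fg gh x; rewrite fg.
- by move=> M N P f f' g g' ff gg x /=; rewrite ff gg.
Defined.

Record is_gsubmod (M : gmod) (L : M -> Prop) : Prop := IsGSubmod {
  gsubmod0 : L 0;
  gsubmodB : forall x y, L x -> L y -> L (x - y);
  gsubmod_act : forall x a, L x -> L (ract x a);
  gsubmod_hom : homogeneous (@gmod_comp M) L
}.

Definition fin_dim (M : gmod) (L : M -> Prop) : Prop :=
  exists (n : nat) (b : 'I_n -> M), forall x,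
    L x <-> exists c : 'I_n -> k, x = \sum_i kscale (c i) (b i).

Definition Fdim (M : gmod) : Prop :=
  forall x : M, exists (n : nat) (L : 'I_n -> M -> Prop) (y : 'I_n -> M),
    (forall i, [/\ is_gsubmod (L i), fin_dim (L i) & L i (y i)]) /\
    x = \sum_i y i.

(* There is an exact sequence 0 -> K -> M -f-> N -> C -> 0 in Gr A with K and C
   in Fdim A, i.e. the kernel and the cokernel of f are in Fdim A. *)
Definition Fdim_iso (M N : Gr) (f : hom M N) : Prop :=
  exists (K C : gmod) (i : ghom K M) (p : ghom N C),
    [/\ Fdim K, Fdim C,
        injective i /\ (forall x : M, f x = 0 <-> exists z, x = i z) &
        (forall c : C, exists y, c = p y) /\
        (forall y : N, p y = 0 <-> exists x, y = f x)].

(* The quotient of the abelian category Gr A by its localizing subcategory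
   Fdim A, i.e. the localization of Gr A at the morphisms whose kernel and
   cokernel are in Fdim A. *)
Definition QGr : category := localization Fdim_iso.

Section Shift.
Variable M : gmod.

Definition shift_comp (i : int) (x : M) : Prop := gmod_comp (i + 1) x.

Fact shift_grading : grading shift_comp.
Proof.
have gM := gmod_grading M; split.
- by move=> i; apply: (grading0 gM).
- by move=> i x y; apply: (gradingB gM).
- move=> x; have [s [f [us fP ->]]] := grading_sum gM x.
  exists [seq i - 1 | i <- s], (fun i => f (i + 1)); split.
  + by rewrite map_inj_uniq //; apply: addIr.
  + by move=> i; apply: fP.
  by rewrite big_map; apply: eq_bigr => i _; rewrite subrK.
move=> s f us fP f0 i si.
have {1}-> : i = (i + 1) - 1 by rewrite addrK.
apply: (grading_free gM (s := [seq j + 1 | j <- s]) (f := fun j => f (j - 1))).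
- by rewrite map_inj_uniq //; apply: addIr.
- by move=> j; have := fP (j - 1); rewrite /shift_comp subrK.
- by rewrite big_map -[RHS]f0; apply: eq_bigr => j _; rewrite addrK.
exact: map_f.
Qed.

Fact shift_comp_act i n (x : M) (a : A) :
  shift_comp i x -> galg_comp n a -> shift_comp (i + n%:Z) ((a : A^c) *: x).
Proof.
by move=> xi an; rewrite /shift_comp addrAC; apply: gmod_comp_act.
Qed.

Definition gshift : gmod := GMod shift_grading shift_comp_act.

End Shift.

Definition QGr_shift (M : QGr) : QGr := gshift M.

End GradedModules.

Arguments QGr {k} A.

(* Main.v *)
(** Let Q' be obtained from Q by subdividing every arrow a of degree d into a
    path of d arrows of degree 1, and let I' be the ideal of k Q' generated by
    the image of (generators of) I.  Let e be the sum of the vertices of Q in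
    A' = k Q'/I'.  Then e A' e is A = k Q/I, and for a vertex v' in the interior
    of the subdivided arrow a, at distance j from its source, right
    multiplication by the j first pieces of a identifies A e_(src a) with
    e A' e_v'.  Hence M |-> M (x) e A' consists of copies of the M e_(src a) with
    their degrees shifted by j, and one has the functors M |-> M (x) e A' and
    N |-> N e between Gr A and Gr A'.  Both are of the same kind: a graded ring
    morphism from one algebra to matrices over the other acts on row vectors.
    The first composite is the identity.  The kernel and the cokernel of
    (N e) (x) e A' -> N are killed by e, hence by all long paths of Q', since
    these pass through a vertex of Q.  As A and A' are degreewise finite, a
    module is in Fdim if and only if each of its elements is killed by all
    elements of large degree, so that both functors and both comparison maps are
    compatible with the localization. *)

From HB Require Import structures.
From mathcomp Require Import all_boot all_algebra finmap boolp zify.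
From mathcomp.multinomials Require Import monalg.
Require Import Defs.

Set Implicit Arguments.
Unset Strict Implicit.
Unset Printing Implicit Defensive.

Import GRing.Theory.

Local Open Scope ring_scope.

(** * Homogeneous components *)

Section GradingProjection.
Variables (D : eqType) (V : zmodType) (C : D -> V -> Prop) (gC : grading C).

Definition gsupp (x : V) : seq D := sval (cid (grading_sum gC x)).

Definition gdec (x : V) : D -> V :=
  sval (cid (svalP (cid (grading_sum gC x)))).

Lemma gdecP x :
  [/\ uniq (gsupp x), forall d, C d (gdec x d) & x = \sum_(d <- gsupp x) gdec x d].
Proof. exact: svalP (cid (svalP (cid (grading_sum gC x)))). Qed.

(** The list [gsupp x] comes from a choice and may contain degrees with zero component; the value of
    [gproj] does not depend on this choice, by [gprojE]. *)
Definition gproj (d : D) (x : V) : V :=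
  if d \in gsupp x then gdec x d else 0.

Lemma gradingD d x y : C d x -> C d y -> C d (x + y).
Proof.
move=> xd yd; rewrite -[y]opprK; apply: (gradingB gC) => //.
by rewrite -sub0r; apply: (gradingB gC) => //; apply: (grading0 gC).
Qed.

Lemma grading_bigsum d (I : Type) (s : seq I) (P : pred I) (F : I -> V) :
  (forall i, P i -> C d (F i)) -> C d (\sum_(i <- s | P i) F i).
Proof.
move=> Fd; apply: big_ind => //.
  exact: (grading0 gC).
by move=> x y; apply: gradingD.
Qed.

Lemma gprojP d x : C d (gproj d x).
Proof.
rewrite /gproj; case: ifP => _; last exact: (grading0 gC).
by have [] := gdecP x.
Qed.

Lemma big_mem_widen (s t : seq D) (f : D -> V) :
  uniq s -> uniq t -> {subset s <= t} ->
  \sum_(d <- t) (if d \in s then f d else 0) = \sum_(d <- s) f d.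
Proof.
move=> us ut st; rewrite -big_mkcond -big_filter; apply: perm_big.
apply: uniq_perm; rewrite ?filter_uniq // => d; rewrite mem_filter.
by case ds: (d \in s) => //=; apply: st.
Qed.

Lemma gproj_sum t x :
  uniq t -> {subset gsupp x <= t} -> \sum_(d <- t) gproj d x = x.
Proof.
move=> ut st; have [us _ xE] := gdecP x; rewrite [RHS]xE.
exact: big_mem_widen.
Qed.

Lemma gsupp_uniq x : uniq (gsupp x).
Proof. by have [] := gdecP x. Qed.

(** Over a list of degrees containing both supports, the chosen decomposition minus the given one
    sums to zero, so each difference vanishes by [grading_free]. *)
Lemma gprojE (s : seq D) (f : D -> V) d :
    uniq s -> (forall d, C d (f d)) ->
  gproj d (\sum_(d <- s) f d) = if d \in s then f d else 0.
Proof.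
move=> us fC; set x := \sum_(d <- s) f d.
pose t := undup (d :: gsupp x ++ s).
have ut : uniq t by apply: undup_uniq.
have dt : d \in t by rewrite mem_undup mem_head.
apply/eqP; rewrite -subr_eq0; apply/eqP; move: dt.
apply: (grading_free gC (s := t)
  (f := fun d => gproj d x - (if d \in s then f d else 0))) => // [e|].
  apply: (gradingB gC); first exact: gprojP.
  by case: ifP => // _; apply: (grading0 gC).
rewrite sumrB gproj_sum // ?big_mem_widen ?subrr // => e; rewrite mem_undup inE mem_cat.
  by move=> ->; rewrite !orbT.
by move=> ->; rewrite orbT.
Qed.

Lemma gproj_id d x : C d x -> gproj d x = x.
Proof.
move=> xd; have {1}-> : x = \sum_(e <- [:: d]) if e == d then x else 0.
  by rewrite big_seq1 eqxx.
rewrite gprojE // ?mem_head ?eqxx // => e.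
by case: eqP => [->//|_]; apply: (grading0 gC).
Qed.

Lemma gproj_neq d e x : C e x -> d != e -> gproj d x = 0.
Proof.
move=> xe de; have -> : x = \sum_(d <- [:: e]) if d == e then x else 0.
  by rewrite big_seq1 eqxx.
rewrite gprojE // ?inE ?(negPf de) // => i.
by case: eqP => [->//|_]; apply: (grading0 gC).
Qed.

Lemma gprojB d : {morph gproj d : x y / x - y}.
Proof.
move=> x y; pose t := undup (d :: gsupp x ++ gsupp y).
have ut : uniq t by apply: undup_uniq.
have dt : d \in t by rewrite mem_undup mem_head.
rewrite -{1}(@gproj_sum t x) //; last first.
  by move=> e; rewrite mem_undup inE mem_cat orbA orbAC orbC => ->.
rewrite -{1}(@gproj_sum t y) //; last first.
  by move=> e; rewrite mem_undup inE mem_cat => ->; rewrite !orbT.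
rewrite -sumrB gprojE ?dt // => e.
by apply: (gradingB gC); apply: gprojP.
Qed.

HB.instance Definition _ d :=
  GRing.isZmodMorphism.Build V V (gproj d) (@gprojB d).

Lemma gproj_eq0 d x : d \notin gsupp x -> gproj d x = 0.
Proof. by rewrite /gproj => /negPf ->. Qed.

Lemma homogeneous_gproj (X : V -> Prop) :
  homogeneous C X -> X 0 -> forall d x, X x -> X (gproj d x).
Proof.
move=> hX X0 d x Xx; have [dx|/gproj_eq0->//] := boolP (d \in gsupp x).
apply: (hX (gsupp x) (fun d => gproj d x)) => //; first exact: gsupp_uniq.
  by move=> e; apply: gprojP.
by rewrite gproj_sum ?gsupp_uniq.
Qed.

Lemma gproj_homogeneous (X : V -> Prop) :
  (forall d x, X x -> X (gproj d x)) -> homogeneous C X.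
Proof. by move=> hX s f us fC /hX + d ds => /(_ d); rewrite gprojE ?ds. Qed.

End GradingProjection.

Section GradingMorphism.
Variables (D : eqType) (V W : zmodType) (C : D -> V -> Prop) (E : D -> W -> Prop).
Variables (gC : grading C) (gE : grading E) (f : {additive V -> W}).

(** The images of the components of [x] form a decomposition of [f x], and decompositions are
    unique. *)
Lemma gproj_morph : (forall d x, C d x -> E d (f x)) ->
  forall d x, f (gproj gC d x) = gproj gE d (f x).
Proof.
move=> fC d x; rewrite -[in RHS](gproj_sum (gsupp_uniq gC x) (fun _ e => e)).
rewrite raddf_sum gprojE ?gsupp_uniq //.
  case: ifPn => // /gproj_eq0 ->; exact: raddf0.
by move=> e; apply: fC; apply: gprojP.
Qed.

End GradingMorphism.

(** * Functors and localization *)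

Section LocalizationFunctor.
Variables (C D : category).
Variables (S : forall x y : C, hom x y -> Prop).
Variables (T : forall x y : D, hom x y -> Prop).
Variables (F : functor C D).
Hypothesis FS : forall (x y : C) (f : hom x y), S f -> T (fhom F f).

Fixpoint loc_map x y (f : lhom S x y) : lhom T (F x) (F y) :=
  match f with
  | Lof _ _ g => Lof _ (fhom F g)
  | Linv _ _ _ Ss => Linv (FS Ss)
  | Lcomp _ _ _ f g => Lcomp (loc_map f) (loc_map g)
  end.

Fact loc_map_heq x y (f g : lhom S x y) :
  lheq f g -> lheq (loc_map f) (loc_map g).
Proof.
elim=> /=.
- by move=> *; apply: lheq_refl.
- by move=> *; apply: lheq_sym.
- by move=> *; apply: lheq_trans; eassumption.
- by move=> *; apply: lheq_comp.
- move=> x1 y1 f1; apply: lheq_trans (lheq_idl _).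
  by apply: lheq_comp (lheq_refl _); apply/lheq_of/fhom_id.
- move=> x1 y1 f1; apply: lheq_trans (lheq_idr _).
  by apply: lheq_comp (lheq_refl _) _; apply/lheq_of/fhom_id.
- by move=> *; apply: lheq_A.
- by move=> *; apply/lheq_of/fhom_heq.
- move=> x1 y1 z1 f1 g1; apply: lheq_trans (lheq_of_comp _ _ _).
  exact/lheq_of/fhom_comp.
- move=> x1 y1 s Ss; apply: lheq_trans (lheq_invr _) _.
  exact/lheq_sym/lheq_of/fhom_id.
move=> x1 y1 s Ss; apply: lheq_trans (lheq_invl _) _.
exact/lheq_sym/lheq_of/fhom_id.
Qed.

Definition loc_functor : functor (localization S) (localization T) :=
  @Functor (localization S) (localization T) F loc_map loc_map_heq
    (fun x => lheq_of _ (fhom_id F x))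
    (fun x y z f g => lheq_refl (Lcomp (loc_map f) (loc_map g))).

End LocalizationFunctor.

Lemma loc_iso (C : category) (S : forall x y : C, hom x y -> Prop) (x y : C)
    (f : hom x y) : S x y f -> is_iso (C := localization S) (Lof S f).
Proof. by move=> Sf; exists (Linv Sf); split; [apply: lheq_invr | apply: lheq_invl]. Qed.

Lemma loc_iso_of (C : category) (S : forall x y : C, hom x y -> Prop)
    (x y : C) (f : hom x y) (g : hom y x) :
    heq (comp f g) (idm x) -> heq (comp g f) (idm y) ->
  is_iso (C := localization S) (Lof S f).
Proof.
move=> fg gf; exists (Lof S g); split; apply: lheq_trans (lheq_sym _) _.
- exact: lheq_of_comp.
- exact: lheq_of.
- exact: lheq_of_comp.
exact: lheq_of.
Qed.

(* A natural transformation between functors on the original categories stays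
   natural on formal inverses because these are two-sided inverses. *)
Lemma loc_nat_isomorphic (C D : category)
    (S : forall x y : C, hom x y -> Prop) (T : forall x y : D, hom x y -> Prop)
    (F : functor C D) (G : functor D C)
    (FS : forall (x y : C) (f : hom x y), S x y f -> T _ _ (fhom F f))
    (GT : forall (x y : D) (f : hom x y), T x y f -> S _ _ (fhom G f))
    (eta : forall x : C, hom (G (F x)) x) :
    (forall x y (f : hom x y),
       heq (comp (fhom G (fhom F f)) (eta y)) (comp (eta x) f)) ->
    (forall x, S _ _ (eta x)) ->
  nat_isomorphic (functor_comp (loc_functor FS) (loc_functor GT))
    (functor_id (localization S)).
Proof.
move=> eta_nat etaS; exists (fun x => Lof S (eta x)).
split=> [x|x y f]; first exact: (loc_iso (etaS x)).
rewrite /=; elim: f => /= {x y}.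
- move=> x y f; apply: lheq_trans (lheq_sym (lheq_of_comp _ _ _)) _.
  by apply: lheq_trans (lheq_of_comp _ _ _); apply: lheq_of.
- move=> x y s Ss; set s' := Linv (GT _ _ _ _); set a := Lof S (eta x).
  set b := Lof S (eta y); set r := Linv Ss.
  have nat : lheq (Lcomp (Lof S (fhom G (fhom F s))) b) (Lcomp a (Lof S s)).
    apply: lheq_trans (lheq_sym (lheq_of_comp _ _ _)) _.
    by apply: lheq_trans (lheq_of_comp _ _ _); apply: lheq_of.
  (* With composites read from left to right, [s' a = s' a s r = s' (G F s) b r = b r]. *)
  apply: lheq_trans (lheq_sym (lheq_idr _)) _.
  apply: lheq_trans (lheq_comp (lheq_refl _) (lheq_sym (lheq_invr Ss))) _.
  apply: lheq_trans (lheq_A _ _ _) _; apply: lheq_comp (lheq_refl _).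
  apply: lheq_trans (lheq_sym (lheq_A _ _ _)) _.
  apply: lheq_trans (lheq_comp (lheq_refl _) (lheq_sym nat)) _.
  apply: lheq_trans (lheq_A _ _ _) _.
  apply: lheq_trans (lheq_comp (lheq_invl _) (lheq_refl _)) _.
  exact: lheq_idl.
move=> x y z f IHf g IHg; apply: lheq_trans (lheq_sym (lheq_A _ _ _)) _.
apply: lheq_trans (lheq_comp (lheq_refl _) IHg) _.
apply: lheq_trans (lheq_A _ _ _) _.
apply: lheq_trans (lheq_comp IHf (lheq_refl _)) _.
exact: lheq_sym (lheq_A _ _ _).
Qed.

(** * Torsion modules *)

Section SubQuotient.
Variables (k : fieldType) (A : gradedAlg k) (M : gmod A) (L : M -> Prop).
Hypothesis hL : is_gsubmod L.

(** The proof of closure is an argument of the predicate, so that the submodule structure can be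
    attached to the predicate itself. *)
Definition gsub_pred of is_gsubmod L : {pred M} := fun x => `[< L x >].

Local Notation P := (gsub_pred hL).

Lemma gsub_predP x : reflect (L x) (x \in P).
Proof. exact: asboolP. Qed.

Fact gsub_pred_submod : submod_closed P.
Proof.
split=> [|a x y]; first exact/gsub_predP/(gsubmod0 hL).
move=> /gsub_predP Lx /gsub_predP Ly; apply/gsub_predP; rewrite -[y]opprK.
apply: (gsubmodB hL); first exact: (gsubmod_act hL).
by rewrite -sub0r; apply: (gsubmodB hL) => //; apply: (gsubmod0 hL).
Qed.

HB.instance Definition _ := GRing.isSubmodClosed.Build _ _ P gsub_pred_submod.

Record gsub_car := GsubCar { gsub_val : M; _ : gsub_val \in P }.

HB.instance Definition _ := [isSub for gsub_val].
HB.instance Definition _ := [Choice of gsub_car by <:].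
HB.instance Definition _ := [SubChoice_isSubZmodule of gsub_car by <:].
HB.instance Definition _ := [SubZmodule_isSubLmodule of gsub_car by <:].

Definition gsub_comp (i : int) (u : gsub_car) : Prop := gmod_comp i (val u).

Fact gsub_grading : grading gsub_comp.
Proof.
have gM := gmod_grading M; split.
- by move=> d; rewrite /gsub_comp raddf0; apply: (grading0 gM).
- by move=> d u v ud vd; rewrite /gsub_comp raddfB; apply: (gradingB gM).
- move=> u; have Lu : L (val u) by apply/gsub_predP/(valP u).
  have Lp d : gproj gM d (val u) \in P.
    apply/gsub_predP; apply: homogeneous_gproj Lu; last exact: (gsubmod0 hL).
    exact: (gsubmod_hom hL).
  exists (gsupp gM (val u)), (fun d => GsubCar (Lp d)); split.
  + exact: gsupp_uniq.
  + by move=> d; apply: gprojP.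
  by apply: val_inj; rewrite raddf_sum /= gproj_sum ?gsupp_uniq.
move=> s f us fC f0 d ds; apply: val_inj; rewrite raddf0.
apply: (grading_free gM (f := fun d => val (f d)) us fC) => //.
by rewrite -raddf_sum f0 raddf0.
Qed.

Fact gsub_comp_act i n (u : gsub_car) (a : A) :
  gsub_comp i u -> galg_comp n a -> gsub_comp (i + n%:Z) ((a : A^c) *: u).
Proof. by move=> ui an; rewrite /gsub_comp linearZ; apply: gmod_comp_act. Qed.

Definition gsub : gmod A := GMod gsub_grading gsub_comp_act.

Definition gsub_incl : ghom gsub M :=
  @GHom _ _ gsub M (val : {linear gsub_car -> M}) (fun _ _ h => h).

Definition gquot_car : Type := Quotient.quot P.

HB.instance Definition _ := GRing.Zmodule.on gquot_car.

Definition gquot_proj (x : M) : gquot_car := \pi_(Quotient.quot P)%qT x.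

Lemma gquot_projP x y : gquot_proj x = gquot_proj y <-> L (x - y).
Proof.
split=> [/eqP|Lxy]; last apply/eqP.
  by rewrite -Quotient.idealrBE => /gsub_predP.
by rewrite -Quotient.idealrBE; apply/gsub_predP.
Qed.

Lemma gquot_proj_surj u : exists x, u = gquot_proj x.
Proof. by exists (repr u); rewrite /gquot_proj reprK. Qed.

Fact gquot_proj_additive : zmod_morphism gquot_proj.
Proof. by move=> x y; rewrite /gquot_proj raddfB. Qed.

HB.instance Definition _ :=
  GRing.isZmodMorphism.Build M gquot_car gquot_proj gquot_proj_additive.

Definition gquot_scale (a : A^c) (u : gquot_car) : gquot_car :=
  gquot_proj (a *: repr u).

Lemma gquot_scale_proj a x : gquot_scale a (gquot_proj x) = gquot_proj (a *: x).
Proof.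
apply/gquot_projP; rewrite -scalerBr; apply: (gsubmod_act hL).
by apply/gquot_projP; rewrite /gquot_proj reprK.
Qed.

Fact gquot_scaleA a b u :
  gquot_scale a (gquot_scale b u) = gquot_scale (a * b) u.
Proof. by have [x ->] := gquot_proj_surj u; rewrite !gquot_scale_proj scalerA. Qed.

Fact gquot_scale1 : left_id 1 gquot_scale.
Proof. by move=> u; have [x ->] := gquot_proj_surj u; rewrite gquot_scale_proj scale1r. Qed.

Fact gquot_scaleDr : right_distributive gquot_scale +%R.
Proof.
move=> a u v; have [x ->] := gquot_proj_surj u.
have [y ->] := gquot_proj_surj v.
by rewrite -raddfD !gquot_scale_proj scalerDr raddfD.
Qed.

Fact gquot_scaleDl u : {morph gquot_scale^~ u : a b / a + b}.
Proof.
by move=> a b; have [x ->] := gquot_proj_surj u;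
  rewrite !gquot_scale_proj scalerDl raddfD.
Qed.

HB.instance Definition _ := GRing.Zmodule_isLmodule.Build A^c gquot_car
  gquot_scaleA gquot_scale1 gquot_scaleDr gquot_scaleDl.

Fact gquot_proj_scalable : scalable gquot_proj.
Proof. by move=> a x; rewrite -gquot_scale_proj. Qed.

HB.instance Definition _ :=
  GRing.isScalable.Build A^c M gquot_car *:%R gquot_proj gquot_proj_scalable.

Definition gquot_comp (i : int) (u : gquot_car) : Prop :=
  exists2 x, gmod_comp i x & u = gquot_proj x.

Fact gquot_grading : grading gquot_comp.
Proof.
have gM := gmod_grading M; split.
- by move=> i; exists 0; [apply: (grading0 gM) | rewrite raddf0].
- move=> i _ _ [x Mx ->] [y My ->]; exists (x - y); last by rewrite raddfB.
  exact: (gradingB gM).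
- move=> u; have [x ->] := gquot_proj_surj u.
  exists (gsupp gM x), (fun d => gquot_proj (gproj gM d x)); split.
  + exact: gsupp_uniq.
  + by move=> d; exists (gproj gM d x) => //; apply: gprojP.
  by rewrite -raddf_sum gproj_sum ?gsupp_uniq.
move=> s f us fC f0 d ds.
(* The sum of the homogeneous lifts [g d] lies in [L], and homogeneity of [L] then puts each of them
   in [L]. *)
have /choice[g gP] : forall d, exists x, gmod_comp d x /\ f d = gquot_proj x.
  by move=> e; have [x Mx fx] := fC e; exists x.
have Lg : L (\sum_(d <- s) g d).
  rewrite -[X in L X]subr0; apply/gquot_projP; rewrite raddf0 raddf_sum -[RHS]f0.
  by apply: eq_bigr => e _; have [_ ->] := gP e.
have [_ ->] := gP d; rewrite -(raddf0 gquot_proj); apply/gquot_projP.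
rewrite subr0; apply: (gsubmod_hom hL us _ Lg ds) => e.
by have [] := gP e.
Qed.

Fact gquot_comp_act i n (u : gquot_car) (a : A) :
  gquot_comp i u -> galg_comp n a -> gquot_comp (i + n%:Z) ((a : A^c) *: u).
Proof.
move=> [x xi ->] an; exists ((a : A^c) *: x); last by rewrite linearZ.
exact: gmod_comp_act.
Qed.

Definition gquot : gmod A := GMod gquot_grading gquot_comp_act.

Definition gquot_map : ghom M gquot :=
  @GHom _ _ M gquot (gquot_proj : {linear M -> gquot_car})
    (fun i x h => ex_intro2 _ _ x h erefl).

End SubQuotient.

Section RightAction.
Variables (k : fieldType) (A : gradedAlg k) (M : gmod A).
Implicit Types (x y : M) (a b : A).

Definition ractr a x := ract x a.

Lemma ractBl a : zmod_morphism (ractr a).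
Proof. by move=> x y; rewrite /ractr /ract scalerBr. Qed.

HB.instance Definition _ a :=
  GRing.isZmodMorphism.Build M M (ractr a) (ractBl a).

Lemma ractBr x : zmod_morphism (@ract k A M x).
Proof. by move=> a b; rewrite /ract scalerBl. Qed.

HB.instance Definition _ x :=
  GRing.isZmodMorphism.Build A M (@ract k A M x) (ractBr x).

Lemma ractM x a b : ract (ract x a) b = ract x (a * b).
Proof. by rewrite /ract scalerA. Qed.

Lemma ract1 x : ract x (1 : A) = x.
Proof. exact: (scale1r x). Qed.

Lemma ract0l a : ract (0 : M) a = 0.
Proof. exact: (raddf0 (ractr a)). Qed.

Lemma ract_suml (I : Type) (s : seq I) (P : pred I) (F : I -> M) a :
  ract (\sum_(i <- s | P i) F i) a = \sum_(i <- s | P i) ract (F i) a.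
Proof. exact: (raddf_sum (ractr a)). Qed.

Lemma ract_gproj_sum x a :
  ract x a = \sum_(n <- gsupp (galg_grading A) a) ract x (gproj (galg_grading A) n a).
Proof. by rewrite -raddf_sum gproj_sum ?gsupp_uniq. Qed.

End RightAction.

Lemma ghom_ract (k : fieldType) (A : gradedAlg k) (M N : gmod A)
  (f : ghom M N) x a : f (ract x a) = ract (f x) a.
Proof. exact: linearZ. Qed.

(** * Torsion elements and the subcategory Fdim *)

Section Torsion.
Variables (k : fieldType) (A : gradedAlg k).
Local Notation gA := (galg_grading A).

(** An elementwise substitute for [Fdim]: it mentions no submodule and so can be checked entry by
    entry on row vectors. *)
Definition torsion (M : gmod A) (x : M) : Prop :=
  exists n, forall m a, (n <= m)%N -> galg_comp m a -> ract x a = 0.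

Lemma torsion_sum (M : gmod A) n (y : 'I_n -> M) :
  (forall i, torsion (y i)) -> torsion (\sum_i y i).
Proof.
move=> /choice[b yb]; exists (\max_i b i) => m a bm am.
rewrite ract_suml big1 // => i _; apply: yb am.
exact: leq_trans (leq_bigmax i) bm.
Qed.

(** A finite-dimensional graded submodule lives in finitely many degrees, and an algebra element of
    large degree moves each of them out of this range. *)
Lemma fin_dim_torsion (M : gmod A) (L : M -> Prop) y :
  is_gsubmod L -> fin_dim L -> L y -> torsion y.
Proof.
move=> hL [N [b Lb]] Ly; have gM := gmod_grading M.
pose S := undup (gsupp gM y ++ flatten [seq gsupp gM (b i) | i <- enum 'I_N]).
have uS : uniq S by apply: undup_uniq.
have yS : y = \sum_(d <- S) gproj gM d y.
  by rewrite gproj_sum // => d dy; rewrite mem_undup mem_cat dy.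
have LS z : L z -> z = \sum_(d <- S) gproj gM d z.
  move=> /Lb[c ->]; rewrite -[LHS](eq_bigr _ (fun i _ => erefl)).
  under [RHS]eq_bigr do rewrite raddf_sum.
  rewrite exchange_big; apply: eq_bigr => i _ /=.
  (* Scalars have degree 0, so every combination of the [b i] lives in the degrees [S]. *)
  have cb d : kscale (c i) (gproj gM d (b i)) = gproj gM d (kscale (c i) (b i)).
    apply: (gproj_morph gM gM (f := ractr (galg_in A (c i)))) => e x xe.
    rewrite -[e]addr0.
    exact: (gmod_comp_act xe (galg_comp_in A (c i))).
  under [RHS]eq_bigr do rewrite -cb.
  rewrite -ract_suml gproj_sum // => d dy; rewrite mem_undup mem_cat.
  by apply/orP; right; apply/flatten_mapP; exists i; rewrite ?mem_enum.
(* The degrees in [S] lie between -D and D, and adding more than 2D to one of them leaves this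
   interval. *)
pose D := (\max_(d <- S) `|d|)%N.
exists (D + D).+1 => m a Dm am.
rewrite [LHS](LS _ (gsubmod_act hL a Ly)); apply: big1_seq => d /andP[_ dS].
rewrite {1}yS ract_suml raddf_sum; apply: big1_seq => e /andP[_ eS].
apply: (gproj_neq _ (gmod_comp_act (gprojP gM e y) am)).
have dD : (`|d| <= D)%N by apply: leq_bigmax_seq.
have eD : (`|e| <= D)%N by apply: leq_bigmax_seq.
by apply/eqP; lia.
Qed.

Lemma Fdim_torsion (M : gmod A) : Fdim M -> forall x : M, torsion x.
Proof.
move=> FM x; have [n [L [y [Ly ->]]]] := FM x.
apply: torsion_sum => i; have [hL fL Li] := Ly i.
exact: fin_dim_torsion hL fL Li.
Qed.

(** Finite dimension of the part of [A] below degree [n], expressed modulo higher degrees: the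
    elements [l] need be neither homogeneous nor of small degree. *)
Definition degreewise_finite : Prop :=
  forall n, exists (N : nat) (l : 'I_N -> A), forall a, exists c : 'I_N -> k,
    forall d, (d < n)%N ->
      gproj gA d a = gproj gA d (\sum_i galg_in A (c i) * l i).

Lemma cyclic_gsubmod (M : gmod A) e (z : M) :
  gmod_comp e z -> is_gsubmod (fun x => exists a, x = ract z a).
Proof.
move=> ze; split.
- by exists 0; rewrite raddf0.
- by move=> _ _ [a ->] [b ->]; exists (a - b); rewrite raddfB.
- by move=> _ b [a ->]; exists (a * b); rewrite ractM.
apply: (gproj_homogeneous (gC := gmod_grading M)) => d _ [a ->].
(* This is the component of [a] in degree [d - e], written as a sum because [d - e] may be
   negative. *)
exists (\sum_(n <- gsupp gA a) if d == e + n%:Z then gproj gA n a else 0).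
rewrite [in LHS]ract_gproj_sum 2!raddf_sum; apply: eq_bigr => n _ /=.
have zn := gmod_comp_act ze (gprojP gA n a).
case: eqP => [->|/eqP ne]; first by rewrite gproj_id.
by rewrite (gproj_neq _ zn ne) raddf0.
Qed.

(** Modulo degrees at least [n], which annihilate [z], every [a] is a combination of finitely many
    [l i]; hence the [z l_i] span. *)
Lemma torsion_cyclic_fin_dim (M : gmod A) (z : M) :
  degreewise_finite -> torsion z -> fin_dim (fun x => exists a, x = ract z a).
Proof.
move=> fA [n zn]; have [N [l lP]] := fA n.
exists N, (fun i => ract z (l i)) => x; split; last first.
  move=> [c ->]; exists (\sum_i galg_in A (c i) * l i); rewrite raddf_sum.
  by apply: eq_bigr => i _; rewrite /= galg_inC /kscale ractM.
move=> [a ->]; have [c cP] := lP a; exists c.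
have -> : \sum_i kscale (c i) (ract z (l i)) = ract z (\sum_i galg_in A (c i) * l i).
  by rewrite raddf_sum; apply: eq_bigr => i _; rewrite /= galg_inC /kscale ractM.
apply/eqP; rewrite -subr_eq0 -raddfB /=; apply/eqP.
rewrite ract_gproj_sum big1 // => d _; have [dn|nd] := ltnP d n.
  by rewrite raddfB /= cP // subrr raddf0.
exact: zn nd (gprojP _ _ _).
Qed.

(** Each homogeneous component of [x] generates a finite-dimensional graded submodule. *)
Lemma torsion_Fdim (M : gmod A) :
  degreewise_finite -> (forall x : M, torsion x) -> Fdim M.
Proof.
move=> fA tM x; have gM := gmod_grading M; pose s := gsupp gM x.
pose y (i : 'I_(size s)) := gproj gM s`_i x.
exists (size s), (fun i x => exists a, x = ract (y i) a), y.
split=> [i|]; last first.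
  by rewrite -[LHS](gproj_sum (gsupp_uniq gM x) (fun _ e => e)) (big_nth 0) big_mkord.
split; last by exists 1; rewrite ract1.
  exact: cyclic_gsubmod (gprojP gM s`_i x).
exact: torsion_cyclic_fin_dim.
Qed.

(** The second clause expresses that the class of [y] in the cokernel is torsion, without forming
    the quotient. *)
Definition torsion_iso (M N : gmod A) (f : ghom M N) : Prop :=
  (forall x, f x = 0 -> torsion x) /\
  (forall y, exists n, forall m a, (n <= m)%N -> galg_comp m a ->
     exists x, ract y a = f x).

Fact ker_gsubmod (M N : gmod A) (f : ghom M N) : is_gsubmod (fun x => f x = 0).
Proof.
split; first exact: raddf0.
- by move=> x y fx fy; rewrite raddfB /= fx fy subr0.
- by move=> x a fx; rewrite ghom_ract fx ract0l.
apply: (gproj_homogeneous (gC := gmod_grading M)) => d x fx.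
rewrite (gproj_morph (gmod_grading M) (gmod_grading N)) => [|e z]; last exact: ghom_comp.
by rewrite /= fx raddf0.
Qed.

Fact im_gsubmod (M N : gmod A) (f : ghom M N) :
  is_gsubmod (fun y => exists x, y = f x).
Proof.
split; first by exists 0; rewrite raddf0.
- by move=> _ _ [x ->] [y ->]; exists (x - y); rewrite raddfB.
- by move=> _ a [x ->]; exists (ract x a); rewrite ghom_ract.
apply: (gproj_homogeneous (gC := gmod_grading N)) => d _ [x ->].
exists (gproj (gmod_grading M) d x).
by rewrite (gproj_morph (gmod_grading M) (gmod_grading N)) // => e z; apply: ghom_comp.
Qed.

(** Conversely to the elementwise reading of the exact sequence, the modules [K] and [C] can be
    taken to be the kernel and the cokernel of [f]. *)
Lemma Fdim_isoP (M N : gmod A) (f : ghom M N) :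
  degreewise_finite -> (@Fdim_iso k A M N f <-> torsion_iso f).
Proof.
move=> fA; split=> [[K [C [i [p [FK FC [i_inj kerf] [p_surj cokf]]]]]]|].
  split=> [x /kerf[z ->]|y].
    have [n zn] := Fdim_torsion FK z; exists n => m a nm am.
    by rewrite -ghom_ract (zn m) // raddf0.
  have [n pn] := Fdim_torsion FC (p y); exists n => m a nm am.
  by apply/cokf; rewrite ghom_ract (pn m).
move=> [tK tC]; exists (gsub (ker_gsubmod f)), (gquot (im_gsubmod f)).
exists (gsub_incl (ker_gsubmod f)), (gquot_map (im_gsubmod f)); split.
- apply: torsion_Fdim => // z; have /gsub_predP/tK[n zn] := valP z.
  exists n => m a nm am; apply: val_inj; rewrite raddf0 -[RHS](zn m a) //.
- apply: torsion_Fdim => // c; have [y ->] := gquot_proj_surj c.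
  have [n yn] := tC y; exists n => m a nm am.
  rewrite -(ghom_ract (gquot_map (im_gsubmod f))) /= -(raddf0 (gquot_proj (im_gsubmod f))).
  by apply/gquot_projP; rewrite subr0; apply: yn am.
- split=> [|x]; first exact: val_inj.
  split=> [fx|[z ->]]; last by have /gsub_predP := valP z.
  by exists (GsubCar (introT (gsub_predP (ker_gsubmod f) x) fx)).
split=> [c|y]; first exact: gquot_proj_surj.
rewrite /= -(raddf0 (gquot_proj (im_gsubmod f))).
by rewrite gquot_projP subr0.
Qed.

End Torsion.

(** * Transfer of modules along matrix morphisms *)

(** Right multiplication by [a] raises every degree by [n], and [d + n] determines [d], so
    components do not mix. *)
Lemma gproj_ract (k : fieldType) (A : gradedAlg k) (M : gmod A) d n (y : M) (a : A) :
    galg_comp n a ->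
  gproj (gmod_grading M) (d + n%:Z) (ract y a) = ract (gproj (gmod_grading M) d y) a.
Proof.
move=> an; have gM := gmod_grading M.
have {1}<- := gproj_sum (gsupp_uniq (gmod_grading M) y) (fun _ e => e).
rewrite ract_suml raddf_sum /=.
have [dy|dy] := boolP (d \in gsupp (gmod_grading M) y); last first.
  rewrite (gproj_eq0 dy) ract0l; apply: big1_seq => e /andP[_ ey].
  apply: (gproj_neq _ (gmod_comp_act (gprojP _ e y) an)).
  by rewrite (inj_eq (addIr _)); apply: contraNneq dy => ->.
rewrite (bigD1_seq d) ?gsupp_uniq //= big1 ?addr0 => [|e ed].
  by rewrite gproj_id //; apply: gmod_comp_act an; apply: gprojP.
apply: (gproj_neq _ (gmod_comp_act (gprojP _ e y) an)).
by rewrite (inj_eq (addIr _)) eq_sym.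
Qed.

(* A graded ring morphism, not necessarily unital, from A to the V x V matrices
   over B; the vertex v of V sits in degree [off v]. *)
Record gmx (k : fieldType) (A B : gradedAlg k) (V : finType) (off : V -> nat) :=
  GMx {
    gmx_fun :> V -> V -> A -> B;
    gmxB : forall v w, zmod_morphism (gmx_fun v w);
    gmxM : forall v w x y,
      gmx_fun v w (x * y) = \sum_u gmx_fun v u x * gmx_fun u w y;
    gmx_comp : forall v w m n x, galg_comp m x ->
      (m + off v = n + off w)%N -> galg_comp n (gmx_fun v w x);
    gmx_comp0 : forall v w m x, galg_comp m x ->
      (m + off v < off w)%N -> gmx_fun v w x = 0
  }.

HB.instance Definition _ k A B V off (t : @gmx k A B V off) v w :=
  GRing.isZmodMorphism.Build A B (gmx_fun t v w) (gmxB t v w).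

Section Transfer.
Variables (k : fieldType) (A B : gradedAlg k) (V : finType) (off : V -> nat).
Variable t : gmx A B off.

Section Carrier.
Variable L : lmodType B^c.

(** The row vector [m] times the matrix of [a]; over the opposite ring, the scaling is an action
    from the right. *)
Definition row_act (m : {ffun V -> L}) (a : A) : {ffun V -> L} :=
  [ffun w => \sum_v (t v w a : B^c) *: m v].

Lemma row_actBl a : {morph row_act^~ a : m n / m - n}.
Proof.
move=> m n; apply/ffunP => w; rewrite !ffunE -sumrB.
by apply: eq_bigr => v _; rewrite !ffunE scalerBr.
Qed.

Lemma row_actDl a : {morph row_act^~ a : m n / m + n}.
Proof.
move=> m n; apply/ffunP => w; rewrite !ffunE -big_split.
by apply: eq_bigr => v _; rewrite !ffunE scalerDr.
Qed.

Lemma row_actDr m : {morph row_act m : a b / a + b}.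
Proof.
move=> a b; apply/ffunP => w; rewrite !ffunE -big_split.
by apply: eq_bigr => v _; rewrite raddfD scalerDl.
Qed.

Lemma row_act0 a : row_act 0 a = 0.
Proof.
by apply/ffunP => w; rewrite !ffunE big1 // => v _; rewrite ffunE scaler0.
Qed.

Lemma row_actM m a b : row_act (row_act m a) b = row_act m (a * b).
Proof.
apply/ffunP => w; rewrite !ffunE.
under eq_bigr do rewrite ffunE scaler_sumr.
rewrite exchange_big; apply: eq_bigr => v _ /=.
rewrite gmxM scaler_suml; apply: eq_bigr => u _.
by rewrite scalerA.
Qed.

(* As [t 1] need not be the identity matrix, only the row vectors that it fixes
   form a unital module. *)
Record row_mod := RowMod {
  row_val : {ffun V -> L};
  _ : row_act row_val 1 == row_val
}.

Definition row_pred : {pred {ffun V -> L}} := fun m => row_act m 1 == m.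

HB.instance Definition _ := [isSub of row_mod for row_val].
HB.instance Definition _ := [Choice of row_mod by <:].

Fact row_pred_closed : zmod_closed row_pred.
Proof.
split=> [|m n]; rewrite !unfold_in; first by rewrite row_act0.
by move=> /eqP mE /eqP nE; rewrite row_actBl mE nE.
Qed.

HB.instance Definition _ := GRing.isZmodClosed.Build _ row_pred row_pred_closed.
HB.instance Definition _ := GRing.SubChoice_isSubZmodule.Build _ row_pred row_mod
  row_pred_closed.

Lemma row_modP (m : row_mod) : row_act (val m) 1 = val m.
Proof. by apply/eqP/(valP m). Qed.

Lemma row_valB (m n : row_mod) v : row_val (m - n) v = row_val m v - row_val n v.
Proof. by rewrite [row_val (m - n)](raddfB (val : row_mod -> {ffun V -> L})) !ffunE. Qed.

Lemma row_val0 v : row_val (0 : row_mod) v = 0.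
Proof. by rewrite -[0 in LHS](subrr 0) row_valB subrr. Qed.

Lemma row_val_sum (I : Type) (s : seq I) (F : I -> row_mod) v :
  row_val (\sum_(i <- s) F i) v = \sum_(i <- s) row_val (F i) v.
Proof.
by rewrite -sum_ffunE [row_val _](raddf_sum (val : row_mod -> {ffun V -> L})).
Qed.

Fact row_act_mod m a : row_act (row_act m a) 1 == row_act m a.
Proof. by rewrite row_actM mulr1. Qed.

Definition row_scale (a : A^c) (m : row_mod) : row_mod :=
  RowMod (row_act_mod (val m) a).

Fact row_scaleA a b m : row_scale a (row_scale b m) = row_scale (a * b) m.
Proof. by apply: val_inj; rewrite /= row_actM. Qed.

Fact row_scale1 : left_id 1 row_scale.
Proof. by move=> m; apply: val_inj; rewrite /= row_modP. Qed.

Fact row_scaleDr : right_distributive row_scale +%R.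
Proof. by move=> a m n; apply: val_inj; rewrite /= row_actDl. Qed.

Fact row_scaleDl m : {morph row_scale^~ m : a b / a + b}.
Proof. by move=> a b; apply: val_inj; rewrite /= row_actDr. Qed.

HB.instance Definition _ := GRing.Zmodule_isLmodule.Build A^c row_mod
  row_scaleA row_scale1 row_scaleDr row_scaleDl.

End Carrier.

Section Module.
Variable M : gmod B.

(** An entry of degree [j] at [v] counts in degree [j + off v], in accordance with [gmx_comp]. *)
Definition transfer_comp (i : int) (m : row_mod M) : Prop :=
  forall v, gmod_comp (i - (off v)%:Z) (val m v).

Fact transfer_grading : grading transfer_comp.
Proof.
pose gM := gmod_grading M; split.
- by move=> i v; rewrite raddf0 ffunE; apply: (grading0 gM).
- by move=> i m n mi ni v; rewrite raddfB !ffunE; apply: (gradingB gM).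
- move=> m; pose s := undup (flatten
    [seq [seq d + (off v)%:Z | d <- gsupp gM (val m v)] | v <- enum V]).
  pose g (d : int) := [ffun v => gproj gM (d - (off v)%:Z) (val m v)].
  (* The components of a row fixed by [t 1] are fixed too: the entry of [t 1] at [(v, w)] has degree
     [off v - off w], or is zero if this is negative. *)
  have gP d : row_act (g d) 1 == g d.
    apply/eqP/ffunP => w; rewrite !ffunE -[in RHS](row_modP m) ffunE raddf_sum.
    apply: eq_bigr => v _; rewrite ffunE.
    have c1 : galg_comp 0 (1 : A) by rewrite -(rmorph1 (galg_in A)); apply: galg_comp_in.
    have [vw|vw] := ltnP (off v) (off w).
      by rewrite (gmx_comp0 t c1) // !scale0r raddf0.
    have tc : galg_comp (off v - off w) (t v w 1).
      by apply: (gmx_comp t c1); rewrite subnK.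
    rewrite [LHS](_ : _ = ract (gproj gM (d - (off v)%:Z) (val m v)) (t v w 1)) //.
    rewrite -[gM]/(gmod_grading M) -(gproj_ract _ _ tc); congr (gproj gM _ _).
    by lia.
  exists s, (fun d => RowMod (gP d)); split; first exact: undup_uniq.
    by move=> d v; rewrite /= ffunE; apply: gprojP.
  apply: val_inj; rewrite raddf_sum /=; apply/ffunP => v; rewrite sum_ffunE.
  under eq_bigr do rewrite ffunE.
  rewrite -[RHS](big_map (fun d => d - (off v)%:Z) predT (fun d => gproj gM d (val m v))).
  rewrite gproj_sum // ?map_inj_uniq ?undup_uniq //; first exact: addIr.
  move=> d dm; rewrite -[d](addrK (off v)%:Z).
  apply: (map_f (fun d => d - (off v)%:Z)); rewrite mem_undup.
  apply/flatten_mapP; exists v; first by rewrite mem_enum.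
  exact: (map_f (fun d => d + (off v)%:Z)).
move=> s f us fC f0 d ds; apply: val_inj; apply/ffunP => v.
rewrite raddf0 ffunE.
have := grading_free gM (s := [seq d - (off v)%:Z | d <- s])
  (f := fun d => val (f (d + (off v)%:Z)) v).
move=> /(_ _ _ _ (d - (off v)%:Z)); rewrite subrK; apply.
- by rewrite map_inj_uniq //; apply: addIr.
- by move=> e; have := fC (e + (off v)%:Z) v; rewrite addrK.
- rewrite big_map; under eq_bigr do rewrite subrK.
  by rewrite -sum_ffunE -raddf_sum f0 raddf0 ffunE.
exact: (map_f (fun d => d - (off v)%:Z)).
Qed.

Fact transfer_comp_act i n (m : row_mod M) (a : A) :
  transfer_comp i m -> galg_comp n a -> transfer_comp (i + n%:Z) ((a : A^c) *: m).
Proof.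
move=> mi an w; rewrite /= ffunE; apply: (grading_bigsum (gmod_grading M)) => v _.
have [vw|vw] := ltnP (n + off v) (off w).
  by rewrite (gmx_comp0 t an) // scale0r; apply: (grading0 (gmod_grading M)).
have tc : galg_comp (n + off v - off w) (t v w a).
  by apply: (gmx_comp t an); rewrite subnK.
have := gmod_comp_act (mi v) tc; congr (gmod_comp _ _); lia.
Qed.

Definition transfer : gmod A := GMod transfer_grading transfer_comp_act.

Lemma row_val_ract (m : transfer) a w :
  row_val (ract m a) w = \sum_v ract (row_val m v) (t v w a).
Proof. by rewrite /= ffunE. Qed.

Lemma row_val_ract1 (m : transfer) w :
  \sum_v ract (row_val m v) (t v w 1) = row_val m w.
Proof. by rewrite -row_val_ract ract1. Qed.

End Module.

Section Morphism.
Variables (M N : gmod B) (f : ghom M N).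

Fact row_map_mod (m : row_mod M) :
  let fm := [ffun v => f (val m v)] in row_act fm 1 == fm.
Proof.
apply/eqP/ffunP => w; rewrite !ffunE -[in RHS](row_modP m) ffunE raddf_sum.
by apply: eq_bigr => v _; rewrite ffunE /= linearZ.
Qed.

Definition row_map (m : row_mod M) : row_mod N := RowMod (row_map_mod m).

Fact row_map_additive : zmod_morphism row_map.
Proof.
by move=> m n; apply: val_inj; apply/ffunP => v; rewrite /= !ffunE raddfB.
Qed.

HB.instance Definition _ :=
  GRing.isZmodMorphism.Build (row_mod M) (row_mod N) row_map row_map_additive.

Fact row_map_scalable : scalable row_map.
Proof.
move=> a m; apply: val_inj; apply/ffunP => w; rewrite /= !ffunE raddf_sum.
by apply: eq_bigr => v _; rewrite ffunE /= linearZ.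
Qed.

HB.instance Definition _ :=
  GRing.isScalable.Build A^c (row_mod M) (row_mod N) *:%R row_map row_map_scalable.

Fact row_map_comp i (m : row_mod M) :
  transfer_comp i m -> transfer_comp i (row_map m).
Proof. by move=> mi v; rewrite /= ffunE; apply: ghom_comp. Qed.

Definition transfer_map : ghom (transfer M) (transfer N) :=
  @GHom _ _ (transfer M) (transfer N) (row_map : {linear row_mod M -> row_mod N})
    row_map_comp.

End Morphism.

Definition transfer_functor : functor (Gr B) (Gr A).
Proof.
exists transfer transfer_map.
- by move=> M N f g fg m; apply: val_inj; apply/ffunP => v; rewrite /= !ffunE fg.
- by move=> M m; apply: val_inj; apply/ffunP => v; rewrite /= !ffunE.
by move=> M N P f g m; apply: val_inj; apply/ffunP => v; rewrite /= !ffunE.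
Defined.

(** Passing from [a] to an entry of its matrix lowers the degree by at most the largest offset [D],
    so both conditions are inherited with bounds increased by [D]. *)
Lemma transfer_torsion_iso (M N : gmod B) (f : ghom M N) :
  torsion_iso f -> torsion_iso (transfer_map f).
Proof.
pose D := (\max_v off v)%N.
have offD v : (off v <= D)%N by apply: leq_bigmax.
have tcomp n m v w a : (n + D <= m)%N -> galg_comp m a ->
    exists2 i, (n <= i)%N & galg_comp i (t v w a).
  move=> nm am; exists (m + off v - off w)%N.
    by move: (offD w) => wD; lia.
  by apply: (gmx_comp t am); rewrite subnK //; move: (offD w) => wD; lia.
case=> fker fcok; split=> [m fm0|y].
  have /choice[n mn] v : torsion (row_val m v).
    by apply: fker; move/(congr1 val)/ffunP/(_ v): fm0; rewrite raddf0 !ffunE.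
  exists (\max_v n v + D)%N => i a ni ai; apply: val_inj; apply/ffunP => w.
  rewrite raddf0 [RHS]ffunE [LHS]row_val_ract big1 // => v _.
  have [i' ni' ti'] := tcomp _ _ v w _ ni ai.
  by apply: (mn v) ti'; apply: leq_trans (leq_bigmax v) ni'.
have /choice[n yn] v := fcok (row_val y v).
exists (\max_v n v + D)%N => i a ni ai.
have /choice[x xE] w : exists x, row_val (ract y a) w = f x.
  rewrite row_val_ract.
  have /choice[x xE] v : exists x, ract (row_val y v) (t v w a) = f x.
    have [i' ni' ti'] := tcomp _ _ v w _ ni ai.
    by apply: (yn v) ti'; apply: leq_trans (leq_bigmax v) ni'.
  by exists (\sum_v x v); rewrite raddf_sum; apply: eq_bigr.
(* The row of preimages need not be fixed by [t 1], so it is multiplied by [t 1]; its image [y a] is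
   not changed by this. *)
exists (RowMod (row_act_mod [ffun w => x w] 1)); apply: val_inj; apply/ffunP => w.
rewrite -[LHS]row_val_ract1; under eq_bigr do rewrite xE -ghom_ract.
by rewrite /= !ffunE raddf_sum; apply: eq_bigr => v _; rewrite ffunE.
Qed.

Section TransferShift.
Variable M : gmod B.

Fact transfer_shift_comp i (m : row_mod M) :
  @transfer_comp (gshift M) i m -> @shift_comp _ _ (transfer M) i m.
Proof. by move=> mi v; have := mi v; rewrite /= /shift_comp addrAC. Qed.

Fact transfer_unshift_comp i (m : row_mod M) :
  @shift_comp _ _ (transfer M) i m -> @transfer_comp (gshift M) i m.
Proof. by move=> mi v; have := mi v; rewrite /= /shift_comp addrAC. Qed.

(** Both modules have the same rows, and their gradings agree because shifting by 1 commutes with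
    shifting by the offsets. *)
Definition transfer_shift : ghom (transfer (gshift M)) (gshift (transfer M)).
Proof.
by exists (@idfun (row_mod M) : {linear row_mod M -> row_mod M});
  apply: transfer_shift_comp.
Defined.

Definition transfer_unshift : ghom (gshift (transfer M)) (transfer (gshift M)).
Proof.
by exists (@idfun (row_mod M) : {linear row_mod M -> row_mod M});
  apply: transfer_unshift_comp.
Defined.

End TransferShift.

End Transfer.

(** * Comparison maps *)

Section Counit.
Variables (k : fieldType) (A B : gradedAlg k).
Variables (V W : finType) (offV : V -> nat) (offW : W -> nat).
Variables (P : gmx B A offV) (T : gmx A B offW) (u : W -> V -> A).
Hypothesis u_comp : forall w v, galg_comp (offW w + offV v) (u w v).
Hypothesis PTu : forall x w v,
  \sum_w' \sum_v' P v v' (T w w' x) * u w' v' = u w v * x.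

(** By [PTu] at 1 the column is [PT(1) u], and multiplying by [P(1)] on the left does not change
    [PT(1)]. *)
Let P1u w v : \sum_v' P v v' 1 * u w v' = u w v.
Proof.
have uE v' := PTu 1 w v'; rewrite -[RHS]mulr1 -[RHS]uE.
under eq_bigr do rewrite -[u w _]mulr1 -uE mulr_sumr.
rewrite exchange_big; apply: eq_bigr => w' _ /=.
under eq_bigr do rewrite mulr_sumr.
rewrite exchange_big; apply: eq_bigr => v' _ /=.
under eq_bigr do rewrite mulrA.
by rewrite -mulr_suml -gmxM mul1r.
Qed.

(* The column [u] becomes invertible on the two-sided ideal of these [x]: its
   kernel and cokernel are annihilated by them. *)
Definition col_splits (x : A) : Prop :=
  (exists t : W -> V -> A,
     forall w v w' v', P v v' (T w w' x) = u w v * t w' v') /\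
  (exists t : W -> V -> A, x = \sum_w \sum_v t w v * u w v).

Lemma PT_M x y w v w' v' : P v v' (T w w' (x * y)) =
  \sum_w1 \sum_v1 P v v1 (T w w1 x) * P v1 v' (T w1 w' y).
Proof.
by rewrite gmxM raddf_sum; apply: eq_bigr => w1 _; rewrite /= gmxM.
Qed.

Lemma col_splits0 : col_splits 0.
Proof.
split; exists (fun _ _ => 0); first by move=> w v w' v'; rewrite mulr0 !raddf0.
by rewrite big1 // => w _; rewrite big1 // => v _; rewrite mul0r.
Qed.

Lemma col_splitsD x y : col_splits x -> col_splits y -> col_splits (x + y).
Proof.
move=> [[t tE] [r rE]] [[t' tE'] [r' rE']].
split; [exists (fun w v => t w v + t' w v) | exists (fun w v => r w v + r' w v)].
  by move=> w v w' v'; rewrite !raddfD /= tE tE' mulrDr.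
rewrite rE rE' -big_split; apply: eq_bigr => w _.
by rewrite -big_split; apply: eq_bigr => v _; rewrite mulrDl.
Qed.

(** [PT(y x) = PT(y) u t = u (y t)], by [PTu]. *)
Lemma col_splitsMl x y : col_splits x -> col_splits (y * x).
Proof.
move=> [[t tE] [r rE]].
split; [exists (fun w v => y * t w v) | exists (fun w v => y * r w v)].
  move=> w v w' v'; rewrite PT_M mulrA -PTu mulr_suml; apply: eq_bigr => w1 _.
  by rewrite mulr_suml; apply: eq_bigr => v1 _; rewrite tE mulrA.
rewrite rE mulr_sumr; apply: eq_bigr => w _.
by rewrite mulr_sumr; apply: eq_bigr => v _; rewrite mulrA.
Qed.

(** If [x = t u], then [x y = t (u y) = (t PT(y)) u] by [PTu], so the coefficients absorb
    [PT(y)]. *)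
Lemma col_splitsMr x y : col_splits x -> col_splits (x * y).
Proof.
move=> [[t tE] [r rE]].
split; [exists (fun w' v' => \sum_w \sum_v t w v * P v v' (T w w' y))
       |exists (fun w' v' => \sum_w \sum_v r w v * P v v' (T w w' y))].
  move=> w v w' v'; rewrite PT_M mulr_sumr; apply: eq_bigr => w1 _.
  by rewrite mulr_sumr; apply: eq_bigr => v1 _; rewrite tE mulrA.
under [RHS]eq_bigr => w' _ do under eq_bigr => v' _ do rewrite mulr_suml.
under [RHS]eq_bigr => w' _ do rewrite exchange_big.
rewrite exchange_big rE mulr_suml; apply: eq_bigr => w _ /=.
under [RHS]eq_bigr => w' _ do under eq_bigr => v' _ do rewrite mulr_suml.
under [RHS]eq_bigr => w' _ do rewrite exchange_big.
rewrite exchange_big mulr_suml; apply: eq_bigr => v _ /=.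
rewrite -mulrA -PTu mulr_sumr; apply: eq_bigr => w' _.
by rewrite mulr_sumr; apply: eq_bigr => v' _; rewrite mulrA.
Qed.

Section Map.
Variable M : gmod A.

Local Notation PM := (transfer P M).
Local Notation TPM := (transfer T (transfer P M)).

Definition counit_raw (m : {ffun W -> row_mod P M}) : M :=
  \sum_w \sum_v ract (row_val (m w) v) (u w v).

Definition counit_map (m : row_mod T PM) : M := counit_raw (row_val m).

Lemma row_val_row_act (m : {ffun W -> PM}) x w v :
  row_val (row_act T m x w) v =
  \sum_w' \sum_v' ract (row_val (m w') v') (P v' v (T w' w x)).
Proof.
rewrite ffunE row_val_sum; apply: eq_bigr => w' _.
exact: (row_val_ract (m w')).
Qed.

(** [(m PT(x)) u = (m u) x] by [PTu]: multiplication by the column is linear. *)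
Lemma counit_raw_act (m : {ffun W -> PM}) x :
  counit_raw (row_act T m x) = ract (counit_raw m) x.
Proof.
rewrite /counit_raw ract_suml.
under eq_bigr => w _ do under eq_bigr => v _ do
  rewrite row_val_row_act ract_suml.
under eq_bigr => w _ do rewrite exchange_big.
rewrite exchange_big; apply: eq_bigr => w' _ /=.
under eq_bigr => w _ do under eq_bigr => v _ do rewrite ract_suml.
under eq_bigr => w _ do rewrite exchange_big.
rewrite exchange_big ract_suml; apply: eq_bigr => v' _ /=.
rewrite ractM -PTu raddf_sum; apply: eq_bigr => w _ /=.
by rewrite raddf_sum; apply: eq_bigr => v _ /=; rewrite ractM.
Qed.

Fact counit_map_additive : zmod_morphism counit_map.
Proof.
move=> m n; rewrite /counit_map /counit_raw -sumrB; apply: eq_bigr => w _.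
rewrite -sumrB; apply: eq_bigr => v _.
by rewrite !row_valB; apply: ractBl.
Qed.

HB.instance Definition _ :=
  GRing.isZmodMorphism.Build (row_mod T PM) M counit_map counit_map_additive.

Fact counit_map_scalable : scalable counit_map.
Proof. by move=> x m; apply: counit_raw_act. Qed.

HB.instance Definition _ :=
  GRing.isScalable.Build A^c (row_mod T PM) M *:%R counit_map counit_map_scalable.

Fact counit_comp i (m : row_mod T PM) : transfer_comp i m -> gmod_comp i (counit_map m).
Proof.
move=> mi; apply: (grading_bigsum (gmod_grading M)) => w _.
apply: (grading_bigsum (gmod_grading M)) => v _.
have := gmod_comp_act (mi w v) (u_comp w v); congr (gmod_comp _ _); lia.
Qed.

Definition counit : ghom TPM M :=
  @GHom _ _ TPM M (counit_map : {linear row_mod T PM -> M}) counit_comp.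

End Map.

Lemma counit_natural (M N : gmod A) (f : ghom M N) (m : transfer T (transfer P M)) :
  counit N (transfer_map T (transfer_map P f) m) = f (counit M m).
Proof.
rewrite /= /counit_map /counit_raw raddf_sum; apply: eq_bigr => w _.
rewrite raddf_sum; apply: eq_bigr => v _.
by rewrite /= ghom_ract !ffunE.
Qed.

(** For [x] of degree at least [D]: if [m u = 0], then [m PT(x) = (m u) t = 0]; and [y x = (y t) u]
    is in the image. *)
Lemma counit_torsion_iso (M : gmod A) D :
    (forall m x, (D <= m)%N -> galg_comp m x -> col_splits x) ->
  torsion_iso (counit M).
Proof.
move=> DP; split=> [m m0|y]; exists D => i x Di xi.
  have [[t tE] _] := DP _ _ Di xi.
  apply: val_inj; apply/ffunP => w; apply: val_inj; apply/ffunP => v.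
  rewrite [in RHS]row_val0.
  rewrite [LHS]row_val_row_act [RHS]row_val0.
  rewrite -[RHS](ract0l M (t w v)) -[in RHS]m0 /= /counit_map /counit_raw ract_suml.
  apply: eq_bigr => w' _; rewrite ract_suml; apply: eq_bigr => v' _.
  by rewrite ractM tE.
have [_ [t xE]] := DP _ _ Di xi.
(* The entries [y t] are made into admissible rows by multiplying with [P 1] and then [T 1]; by
   [P1u] and [counit_raw_act] this does not affect the product with [u]. *)
pose r w : transfer P M := RowMod (row_act_mod P [ffun v => ract y (t w v)] 1).
exists (RowMod (row_act_mod T [ffun w => r w : transfer P M] 1)).
rewrite /= /counit_map [counit_raw _]counit_raw_act ract1 /counit_raw.
rewrite xE raddf_sum; apply: eq_bigr => w _ /=; rewrite ffunE raddf_sum /=.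
under [RHS]eq_bigr do rewrite ffunE ract_suml.
rewrite exchange_big; apply: eq_bigr => v _ /=.
rewrite -P1u mulr_sumr raddf_sum; apply: eq_bigr => v' _ /=.
by rewrite ffunE -[ract (_ *: _) _]/(ract (ract (ract _ _) _) _) !ractM mulrA.
Qed.

End Counit.

(** * Matrix morphisms between quotient algebras *)

Section QuotientTransfer.
Variables (k : fieldType) (A B : gradedAlg k) (I : ideal A) (J : ideal B).
Variables (homI : homogeneous_ideal I) (homJ : homogeneous_ideal J).
Variables (V : finType) (off : V -> nat) (t : gmx A B off).
Hypothesis tIJ : forall v w x, I x -> J (t v w x).

Definition gmx_quot_fun v w (x : quotAlg homI) : quotAlg homJ :=
  iproj J (t v w (repr x)).

Lemma gmx_quot_proj v w x : gmx_quot_fun v w (iproj I x) = iproj J (t v w x).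
Proof.
apply/iprojP; rewrite -raddfB; apply: tIJ; apply/iprojP.
by rewrite /iproj reprK.
Qed.

Fact gmx_quotB v w : zmod_morphism (gmx_quot_fun v w).
Proof.
move=> u u'; have [x ->] := iproj_surj u; have [y ->] := iproj_surj u'.
by rewrite -raddfB !gmx_quot_proj gmxB raddfB.
Qed.

Fact gmx_quotM v w x y :
  gmx_quot_fun v w (x * y) = \sum_u gmx_quot_fun v u x * gmx_quot_fun u w y.
Proof.
have [{}x ->] := iproj_surj x; have [{}y ->] := iproj_surj y.
rewrite -rmorphM gmx_quot_proj gmxM raddf_sum; apply: eq_bigr => u _.
by rewrite !gmx_quot_proj; apply: rmorphM.
Qed.

Fact gmx_quot_comp v w m n x : galg_comp m x -> (m + off v = n + off w)%N ->
  galg_comp n (gmx_quot_fun v w x).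
Proof.
move=> [{}x xm ->] mn; rewrite gmx_quot_proj; exists (t v w x) => //.
exact: gmx_comp xm mn.
Qed.

Fact gmx_quot_comp0 v w m x : galg_comp m x -> (m + off v < off w)%N ->
  gmx_quot_fun v w x = 0.
Proof.
by move=> [{}x xm ->] mn; rewrite gmx_quot_proj (gmx_comp0 t xm mn) raddf0.
Qed.

Definition gmx_quot : gmx (quotAlg homI) (quotAlg homJ) off :=
  GMx gmx_quotB gmx_quotM gmx_quot_comp gmx_quot_comp0.

End QuotientTransfer.

Lemma quot_degreewise_finite (k : fieldType) (A : gradedAlg k) (I : ideal A)
    (homI : homogeneous_ideal I) :
  degreewise_finite A -> degreewise_finite (quotAlg homI).
Proof.
move=> fA n; have [N [l lP]] := fA n; exists N, (fun i => iproj I (l i)) => u.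
have [x ->] := iproj_surj u; have [c cP] := lP x; exists c => d dn.
pose p := iproj I : {additive A -> quotAlg homI}.
have -> : \sum_i galg_in (quotAlg homI) (c i) * iproj I (l i) =
          p (\sum_i galg_in A (c i) * l i).
  by rewrite raddf_sum; apply: eq_bigr => i _; rewrite [RHS]rmorphM.
have pP e z : galg_comp e z -> @galg_comp _ (quotAlg homI) e (p z) by exists z.
rewrite -[iproj I x]/(p x) -(gproj_morph (galg_grading A) _ pP).
by rewrite -(gproj_morph (galg_grading A) _ pP) cP.
Qed.

(** * Path algebras *)

Section PathGenerators.
Variables (k : fieldType) (Q : wquiver).
Local Notation A := (pathAlg k Q).

Definition pgen (p : qpath Q) : A := locked (<< 1 *g p >> : pathRing k Q).

Lemma pgenE p : pgen p = << 1 *g p >>.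
Proof. by rewrite /pgen -lock. Qed.

Definition pvertex (v : vertex Q) : A := pgen (triv_path v).

Fact arrow_composable (a : arrow Q) : composable (src a) [:: a].
Proof. by rewrite /= eqxx. Qed.

Definition parrow (a : arrow Q) : A := pgen (@QPath Q (src a, [:: a]) (arrow_composable a)).

Lemma galg_in_scale c (x : A) : galg_in A c * x = c *: (x : pathRing k Q).
Proof. exact: pathRing_mul_in. Qed.

Lemma pathAlg_ind (X : A -> Prop) : X 0 -> (forall x y, X x -> X y -> X (x + y)) ->
  (forall c p, X (galg_in A c * pgen p)) -> forall x, X x.
Proof.
move=> X0 XD Xp x; rewrite (monalgE (x : pathRing k Q)).
apply: big_ind => // p _; have := Xp x@_p p.
by rewrite pgenE galg_in_scale scale_monom mulr1.
Qed.

Lemma pgenM p q : pgen p * pgen q = if path_mul p q is Some r then pgen r else 0.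
Proof.
rewrite !pgenE (pathRing_mulUU (1 : k) 1 p q : (<< 1 *g p >> : A) * << 1 *g q >> = _).
by case: path_mul => //= r; rewrite mulr1 pgenE.
Qed.

Lemma pvertex_pgen v p : pvertex v * pgen p = if v == path_src p then pgen p else 0.
Proof. by rewrite pgenM path_mul_trivl; case: eqP. Qed.

Lemma pvertexM v w : pvertex v * pvertex w = if v == w then pvertex w else 0.
Proof. exact: pvertex_pgen. Qed.

Lemma pgen_pvertex v p : pgen p * pvertex v = if v == path_tgt p then pgen p else 0.
Proof. by rewrite pgenM path_mul_trivr; case: eqP. Qed.

Lemma pvertex_arrow v a : pvertex v * parrow a = if v == src a then parrow a else 0.
Proof. exact: pvertex_pgen. Qed.

Lemma arrow_pvertex v a : parrow a * pvertex v = if v == tgt a then parrow a else 0.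
Proof. exact: pgen_pvertex. Qed.

Lemma sum_pvertex : \sum_v pvertex v = 1.
Proof. by under eq_bigr do rewrite /pvertex pgenE. Qed.

Lemma pgen_cons v a s (h : composable v (a :: s)) (h' : composable (tgt a) s) :
  pgen (@QPath Q (v, a :: s) h) = parrow a * pgen (@QPath Q (tgt a, s) h').
Proof.
rewrite pgenM; case: path_mulP => [r _ g _ b|]; last by case.
congr pgen; apply: qpath_eq; last by rewrite b.
by rewrite g; have /andP[/eqP e _] := h; rewrite /path_src /= e.
Qed.

Lemma pgen_cat v s1 s2 (h : composable v (s1 ++ s2)) (h1 : composable v s1)
    (h2 : composable (last v (map (@tgt Q) s1)) s2) :
  pgen (@QPath Q (v, s1 ++ s2) h) =
  pgen (@QPath Q (v, s1) h1) * pgen (@QPath Q (_, s2) h2).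
Proof.
rewrite pgenM; case: path_mulP => [r _ g _ b|]; last by case.
by congr pgen; apply: qpath_eq; rewrite ?g ?b.
Qed.

(** Every path is a product of arrows and a trivial path, so identities between matrix morphisms
    reduce to vertices and arrows. *)
Lemma pathAlg_gen (X : A -> Prop) :
    (forall x y, X x -> X y -> X (x + y)) -> (forall c x, X x -> X (galg_in A c * x)) ->
    (forall x y, X x -> X y -> X (x * y)) ->
    (forall v, X (pvertex v)) -> (forall a, X (parrow a)) ->
  X 0 -> forall x, X x.
Proof.
move=> XD Xc XM Xv Xa X0; apply: pathAlg_ind => // c p; apply: Xc.
case: p => [[v s] h]; elim: s v h => [|a s IHs] v h.
  have -> : @QPath Q (v, [::]) h = triv_path v by apply: qpath_eq.
  exact: Xv.
have h' : composable (tgt a) s by move: h => /= /andP[].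
by rewrite (pgen_cons h h'); apply: XM.
Qed.

Lemma pgen_comp p : galg_comp (path_deg p) (pgen p).
Proof. by rewrite pgenE; apply: path_compU. Qed.

Lemma pvertex_comp v : galg_comp 0 (pvertex v).
Proof.
have <- : path_deg (triv_path v) = 0%N by rewrite /path_deg big_nil.
exact: pgen_comp.
Qed.

Lemma parrow_comp a : galg_comp (deg a) (parrow a).
Proof.
pose p := @QPath Q (src a, [:: a]) (arrow_composable a).
have <- : path_deg p = deg a by rewrite /path_deg big_seq1.
exact: pgen_comp.
Qed.

Lemma size_path_deg (p : qpath Q) : (size (path_arrows p) <= path_deg p)%N.
Proof.
rewrite /path_deg; elim: (path_arrows p) => // a s IHs.
by rewrite big_cons /= -add1n leq_add // deg_gt0.
Qed.

(** Arrows have positive degree, so a path of degree below [n] has fewer than [n] arrows; there are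
    finitely many of these. *)
Lemma pathAlg_degreewise_finite : degreewise_finite A.
Proof.
move=> n; pose T : finType := (vertex Q * {bseq n of arrow Q})%type.
(* Pairs that do not form a path index the element 0. *)
pose l (i : T) : A :=
  if insub (i.1, val i.2) is Some p then pgen p else 0.
exists #|T|, (fun i => l (enum_val i)); apply: pathAlg_ind => [|x y [c cP] [d dP]|c p].
- exists (fun=> 0) => d _; congr gproj; rewrite big1 // => i _.
  by rewrite raddf0 mul0r.
- exists (fun i => c i + d i) => e en.
  under eq_bigr do rewrite rmorphD mulrDl.
  by rewrite big_split !raddfD /= cP // dP.
have [pn|np] := leqP (size (path_arrows p)) n; last first.
  exists (fun=> 0) => d dn; rewrite [X in _ = gproj _ _ X]big1 => [|i _]; last first.
    by rewrite raddf0 mul0r.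
  have cp : galg_comp (0 + path_deg p) (galg_in A c * pgen p).
    by apply: galg_compM; [apply: galg_comp_in | apply: pgen_comp].
  rewrite raddf0 (gproj_neq _ cp) // add0n neq_ltn.
  by rewrite (leq_trans _ (size_path_deg p)) // (ltn_trans dn).
pose i0 : T := (path_src p, Bseq pn).
exists (fun i => if enum_val i == i0 then c else 0) => d _; congr gproj.
rewrite (bigD1 (enum_rank i0)) //= enum_rankK eqxx big1 ?addr0 => [|i ii0].
  congr (_ * _); rewrite /l insubT /=; first by case: (p) => -[].
  by move=> h; congr pgen; apply: qpath_eq.
case: eqP => [ei|_]; last by rewrite raddf0 mul0r.
by rewrite -ei enum_valK eqxx in ii0.
Qed.

End PathGenerators.

(* Vertices act by the idempotents [E v] and arrows by [f a], with [f a] in the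
   corner cut out by the end points; the entry (v, w) of the resulting matrix
   collects the paths from v to w. *)
Section Representation.
Variables (k : fieldType) (Q : wquiver) (B : gradedAlg k).
Variables (E : vertex Q -> B) (f : arrow Q -> B) (off : vertex Q -> nat).
Hypotheses (EE : forall v, E v * E v = E v).
Hypotheses (Ef : forall a, E (src a) * f a = f a).
Hypotheses (fE : forall a, f a * E (tgt a) = f a).
Hypotheses (E_comp : forall v, galg_comp 0 (E v)).
Hypotheses (f_comp : forall a,
  exists2 d, galg_comp d (f a) & (d + off (tgt a) = deg a + off (src a))%N).

Local Notation A := (pathAlg k Q).

Fixpoint word (v : vertex Q) (s : seq (arrow Q)) : B :=
  if s is a :: s' then f a * word (tgt a) s' else E v.

Lemma word_idl v s : composable v s -> E v * word v s = word v s.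
Proof.
case: s => //= a s /andP[/eqP <- _]; by rewrite mulrA Ef.
Qed.

Lemma word_cat v s1 s2 : composable v (s1 ++ s2) ->
  word v (s1 ++ s2) = word v s1 * word (last v (map (@tgt Q) s1)) s2.
Proof.
elim: s1 v => [|a s IHs] v /=; first by move/word_idl->.
by case/andP=> _ /IHs->; rewrite mulrA.
Qed.

(** The relation [f_comp] between degrees and offsets telescopes along the word. *)
Lemma word_comp v s : composable v s ->
  exists2 d, galg_comp d (word v s) &
    (d + off (last v (map (@tgt Q) s)) = \sum_(a <- s) deg a + off v)%N.
Proof.
elim: s v => [|a s IHs] v /=; first by exists 0%N; rewrite ?big_nil.
case/andP=> /eqP <- /IHs[d wd dE]; have [e fe eE] := f_comp a.
by exists (e + d)%N; [apply: galg_compM | rewrite big_cons; lia].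
Qed.

Definition path_entry v w (p : qpath Q) : B :=
  if (path_src p == v) && (path_tgt p == w) then word (path_src p) (path_arrows p)
  else 0.

Definition rep v w (x : A) : B :=
  \sum_(p <- msupp (x : pathRing k Q)) galg_in B (x : pathRing k Q)@_p * path_entry v w p.

Lemma rep_widen v w (d : {fset qpath Q}) (x : A) :
  (msupp (x : pathRing k Q) `<=` d)%fset ->
  rep v w x = \sum_(p <- d) galg_in B (x : pathRing k Q)@_p * path_entry v w p.
Proof.
move=> xd; apply: big_fset_incl => // p _ /mcoeff_outdom ->.
by rewrite raddf0 mul0r.
Qed.

Fact repB v w : zmod_morphism (rep v w).
Proof.
move=> x y; pose d := (msupp (x : pathRing k Q) `|` msupp (y : pathRing k Q))%fset.
rewrite (@rep_widen v w d (x - y)) ?msuppB_le // (@rep_widen v w d x) ?fsubsetUl //.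
rewrite (@rep_widen v w d y) ?fsubsetUr // -sumrB; apply: eq_bigr => p _.
by rewrite mcoeffB raddfB mulrBl.
Qed.

HB.instance Definition _ v w := GRing.isZmodMorphism.Build A B (rep v w) (repB v w).

Lemma rep_pgen v w p : rep v w (pgen k p) = path_entry v w p.
Proof.
rewrite pgenE (@rep_widen v w [fset p]%fset) ?msuppU_le // big_seq_fset1 mcoeffUU.
by rewrite rmorph1 mul1r.
Qed.

Lemma rep_in v w c x : rep v w (galg_in A c * x) = galg_in B c * rep v w x.
Proof.
rewrite galg_in_scale (@rep_widen v w (msupp (x : pathRing k Q))).
  rewrite mulr_sumr; apply: eq_bigr => p _.
  by rewrite mcoeffZ rmorphM mulrA.
exact: msuppZ_le.
Qed.

Lemma rep_pvertex v w u : rep v w (pvertex k u) = if (u == v) && (u == w) then E u else 0.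
Proof. by rewrite rep_pgen. Qed.

(** The word of one arrow ends in the idempotent of its target, which [fE] absorbs. *)
Lemma rep_parrow v w a :
  rep v w (parrow k a) = if (src a == v) && (tgt a == w) then f a else 0.
Proof. by rewrite rep_pgen /path_entry /path_tgt /path_src /= fE. Qed.

(** Only [u = path_tgt p] contributes to the sum, and the entry of [q] there vanishes unless [q]
    starts at [u]. *)
Lemma path_entryM v w p q :
  (if path_mul p q is Some r then path_entry v w r else 0) =
  \sum_u path_entry v u p * path_entry u w q.
Proof.
rewrite (bigD1 (path_tgt p)) //= big1 ?addr0 => [|u up]; last first.
  by rewrite /path_entry [_ == u]eq_sym (negPf up) andbF mul0r.
rewrite /path_entry eqxx andbT; case: path_mulP => [r e g h b|/eqP].
  rewrite g h -e eqxx /=; case: (_ == v); last by rewrite mul0r.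
  case: (_ == w); rewrite ?mulr0 //= b word_cat //.
  by have := valP r; rewrite -[(val r).1]/(path_src r) -[(val r).2]/(path_arrows r) g b.
by rewrite eq_sym => /negPf ->; rewrite mulr0.
Qed.

Fact repM v w (x y : A) : rep v w (x * y) = \sum_u rep v u x * rep u w y.
Proof.
elim/pathAlg_ind: x => [|x x' IHx IHx'|c p].
- by rewrite mul0r raddf0 big1 // => u _; rewrite raddf0 mul0r.
- rewrite mulrDl raddfD /= IHx IHx' -big_split; apply: eq_bigr => u _.
  by rewrite raddfD mulrDl.
elim/pathAlg_ind: y => [|y y' IHy IHy'|d q].
- by rewrite mulr0 raddf0 big1 // => u _; rewrite raddf0 mulr0.
- rewrite mulrDr raddfD /= IHy IHy' -big_split; apply: eq_bigr => u _.
  by rewrite raddfD mulrDr.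
have -> : galg_in A c * pgen k p * (galg_in A d * pgen k q) =
    galg_in A c * (galg_in A d * (pgen k p * pgen k q)).
  by rewrite -mulrA; congr (_ * _); rewrite !mulrA galg_inC.
rewrite !rep_in pgenM.
have -> : rep v w (if path_mul p q is Some r then pgen k r else 0) =
    if path_mul p q is Some r then path_entry v w r else 0.
  by case: path_mul => [r|]; rewrite ?rep_pgen ?raddf0.
rewrite path_entryM !mulr_sumr; apply: eq_bigr => u _.
rewrite !rep_in !rep_pgen -!mulrA; congr (_ * _).
by rewrite !mulrA [galg_in B d * _]galg_inC.
Qed.

Lemma path_entry_comp v w p : path_entry v w p = 0 \/
  exists2 d, galg_comp d (path_entry v w p) & (d + off w = path_deg p + off v)%N.
Proof.
rewrite /path_entry; case: eqP => [pv|]; last by left.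
case: eqP => [pw|]; last by left.
right; have [d wd dE] := word_comp (valP p); exists d => //.
by rewrite -pv -pw.
Qed.

Fact rep_comp v w m n x : galg_comp m x ->
  (m + off v = n + off w)%N -> galg_comp n (rep v w x).
Proof.
move=> xm mn; rewrite /rep big_seq.
apply: (grading_bigsum (galg_grading B)) => p /xm pm.
have [->|[d pd dE]] := path_entry_comp v w p.
  by rewrite mulr0; apply: (grading0 (galg_grading B)).
have <- : (0 + d)%N = n by lia.
by apply: galg_compM pd; apply: galg_comp_in.
Qed.

Fact rep_comp0 v w m x : galg_comp m x ->
  (m + off v < off w)%N -> rep v w x = 0.
Proof.
move=> xm mn; rewrite /rep big_seq big1 // => p /xm pm.
have [->|[d pd dE]] := path_entry_comp v w p; first by rewrite mulr0.
by lia.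
Qed.

Definition rep_gmx : gmx A B off := GMx repB repM rep_comp rep_comp0.

End Representation.

Section QuotientCounit.
Variables (k : fieldType) (A B : gradedAlg k) (I : ideal A) (J : ideal B).
Variables (homI : homogeneous_ideal I) (homJ : homogeneous_ideal J).
Variables (V W : finType) (offV : V -> nat) (offW : W -> nat).
Variables (P : gmx B A offV) (T : gmx A B offW) (u : W -> V -> A).
Hypotheses (PJI : forall v v' x, J x -> I (P v v' x)).
Hypotheses (TIJ : forall w w' x, I x -> J (T w w' x)).
Local Notation Pq := (gmx_quot homJ homI PJI).
Local Notation Tq := (gmx_quot homI homJ TIJ).
Local Notation uq := (fun w v => iproj I (u w v) : quotAlg homI).

Lemma PT_quot w v w' v' x :
  Pq v v' (Tq w w' (iproj I x)) = iproj I (P v v' (T w w' x)).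
Proof. by rewrite /= !gmx_quot_proj. Qed.

Lemma PTu_quot :
  (forall x w v, \sum_w' \sum_v' P v v' (T w w' x) * u w' v' = u w v * x) ->
  forall x w v, \sum_w' \sum_v' Pq v v' (Tq w w' x) * uq w' v' = uq w v * x.
Proof.
move=> PTu x w v; have [{}x ->] := iproj_surj x.
rewrite -[RHS]rmorphM -PTu raddf_sum; apply: eq_bigr => w' _ /=.
rewrite raddf_sum; apply: eq_bigr => v' _ /=.
by rewrite [X in X * _]PT_quot -[LHS]rmorphM.
Qed.

Lemma u_quot_comp : (forall w v, galg_comp (offW w + offV v) (u w v)) ->
  forall w v, galg_comp (offW w + offV v) (uq w v).
Proof. by move=> u_comp w v; exists (u w v). Qed.

Lemma col_splits_quot x : col_splits P T u x -> col_splits Pq Tq uq (iproj I x).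
Proof.
move=> [[t tE] [r rE]].
split; [exists (fun w v => iproj I (t w v)) | exists (fun w v => iproj I (r w v))].
  by move=> w v w' v'; rewrite PT_quot tE; apply: rmorphM.
rewrite rE raddf_sum; apply: eq_bigr => w _ /=.
by rewrite raddf_sum; apply: eq_bigr => v _; apply: rmorphM.
Qed.

End QuotientCounit.

(** * Subdivision of arrows *)

Section Subdivision.
Variable Q : wquiver.

Definition sub_vertex : finType := (vertex Q + {a : arrow Q & 'I_(deg a).-1})%type.
Definition sub_arrow : finType := {a : arrow Q & 'I_(deg a)}.

(* The subdivided arrow [a] runs through [sub_pos a 0], ..., [sub_pos a (deg a)];
   larger indices give its target as well. *)
Definition sub_pos (a : arrow Q) (i : nat) : sub_vertex :=
  if i is j.+1 then
    if insub j : option 'I_(deg a).-1 is Some o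
    then inr (Tagged (fun a => 'I_(deg a).-1) o) else inl (tgt a)
  else inl (src a).

Arguments sub_pos : simpl never.

Definition piece_of (b : sub_arrow) : arrow Q := tag b.
Definition piece_idx (b : sub_arrow) : nat := tagged b.

Lemma piece_idx_lt b : (piece_idx b < deg (piece_of b))%N.
Proof. exact: ltn_ord. Qed.

Definition subdivision : wquiver :=
  @WQuiver sub_vertex sub_arrow
    (fun b => sub_pos (piece_of b) (piece_idx b))
    (fun b => sub_pos (piece_of b) (piece_idx b).+1)
    (fun _ => 1%N) (fun _ => isT).

Definition piece a i (h : (i < deg a)%N) : arrow subdivision :=
  Tagged (fun a => 'I_(deg a)) (Ordinal h).

Definition sub_base (v : sub_vertex) : vertex Q :=
  match v with inl v => v | inr o => src (tag o) end.

(** Interior vertices are numbered from 0; number [j] lies at distance [j + 1] from the source of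
    its arrow. *)
Definition sub_depth (v : sub_vertex) : nat :=
  match v with inl v => 0%N | inr o => (tagged o).+1 end.

Lemma sub_pos_deg a : sub_pos a (deg a) = inl (tgt a).
Proof.
have := deg_gt0 a; case e: (deg a) => [|d] // _; rewrite /sub_pos insubF //.
by rewrite e ltnn.
Qed.

Lemma sub_posS a i (h : (i < (deg a).-1)%N) :
  sub_pos a i.+1 = inr (Tagged (fun a => 'I_(deg a).-1) (Ordinal h)).
Proof. by rewrite /sub_pos insubT. Qed.

Lemma sub_base_pos a i : (i < deg a)%N -> sub_base (sub_pos a i) = src a.
Proof.
by case: i => // i ia; have h : (i < (deg a).-1)%N by [lia]; rewrite (sub_posS h).
Qed.

Lemma sub_depth_pos a i : (i < deg a)%N -> sub_depth (sub_pos a i) = i.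
Proof.
by case: i => // i ia; have h : (i < (deg a).-1)%N by [lia]; rewrite (sub_posS h).
Qed.

(* From the [i]-th vertex on the subdivided arrow [a], the only way out leads to
   the target of [a], which is at distance [deg a - i]. *)
Lemma sub_path_split n a i (s : seq (arrow subdivision)) :
    (i <= deg a)%N -> (deg a - i <= n)%N ->
    @composable subdivision (sub_pos a i) s -> (n <= size s)%N ->
  exists s1 s2 z, s = s1 ++ s2 /\
    last (sub_pos a i) (map (@tgt subdivision) s1) = inl z.
Proof.
elim: n i s => [|n IHn] i s ia ni; last case: (ltngtP i (deg a)) ia => // [ia|->] _.
- move=> _ _; exists [::], s, (tgt a); split=> //=.
  by rewrite -sub_pos_deg; congr sub_pos; lia.
- case: i ia ni => [|i] ia ni; first by move=> _ _; exists [::], s, (src a).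
  case: s => //= b s /andP[/eqP bi bs] ns.
  have h : (i < (deg a).-1)%N by lia.
  (* An interior vertex determines the arrow and the index of the piece that leaves it. *)
  have e : sub_pos (piece_of b) (piece_idx b).+1 = sub_pos a i.+2.
    move: bi (piece_idx_lt b); rewrite (sub_posS h).
    case: (piece_idx b) => [|j] //= bi jb.
    have h' : (j < (deg (piece_of b)).-1)%N by lia.
    rewrite (sub_posS h') in bi.
    have [ca] := congr1 (fun v => if v is inr o then Some (tag o) else None) bi.
    by have [ji] := congr1 (@sub_depth) bi; rewrite ca ji.
  rewrite e in bs; have ni' : (deg a - i.+2 <= n)%N by lia.
  have [s1 [s2 [z [-> lz]]]] := IHn i.+2 s ia ni' bs ns.
  by exists (b :: s1), s2, z; split=> //=; rewrite e.
move=> _ _; exists [::], s, (tgt a); split=> //=; exact: sub_pos_deg.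
Qed.

End Subdivision.

Arguments sub_pos : simpl never.

(** * Subdivision and contraction as matrix morphisms *)

Section SubdivisionMaps.
Variables (k : fieldType) (Q : wquiver).
Local Notation S := (subdivision Q).
Local Notation A := (pathAlg k Q).
Local Notation B := (pathAlg k (subdivision Q)).

Definition sub_vtx (v : vertex Q) : vertex S := inl v.

(** The path formed by the first [i] pieces of [a]; the default 0 makes it vanish for [i] beyond
    [deg a]. *)
Fixpoint segment (a : arrow Q) (i : nat) : B :=
  if i is j.+1 then
    segment a j * (if ltnP j (deg a) is LtnNotGeq h then parrow k (piece h) else 0)
  else pvertex k (sub_vtx (src a)).

Lemma segmentS a i (h : (i < deg a)%N) :
  segment a i.+1 = segment a i * parrow k (piece h).
Proof.
rewrite /=; case: ltnP => [h'|]; last by rewrite leqNgt h.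
by rewrite (bool_irrelevance h h').
Qed.

Lemma segment_src a i : pvertex k (sub_vtx (src a)) * segment a i = segment a i.
Proof. by elim: i => [|i IHi] /=; rewrite ?pvertexM ?eqxx // mulrA IHi. Qed.

Lemma segment_tgt a i : (i <= deg a)%N ->
  segment a i * pvertex k (sub_pos a i : vertex S) = segment a i.
Proof.
case: i => [|i] ia; first by rewrite /= pvertexM eqxx.
by rewrite (segmentS ia) -mulrA arrow_pvertex eqxx.
Qed.

Lemma segment_end a :
  segment a (deg a) * pvertex k (sub_vtx (tgt a)) = segment a (deg a).
Proof. by have := segment_tgt (leqnn (deg a)); rewrite sub_pos_deg. Qed.

Lemma segment_comp a i : (i <= deg a)%N -> galg_comp i (segment a i).
Proof.
elim: i => [|i IHi] ia; first exact: pvertex_comp.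
rewrite (segmentS ia).
by have := galg_compM (IHi (ltnW ia)) (@parrow_comp k S (piece ia)); rewrite addn1.
Qed.

Lemma pvertexK (Q' : wquiver) (v : vertex Q') : pvertex k v * pvertex k v = pvertex k v.
Proof. by rewrite pvertexM eqxx. Qed.

(** All offsets are 0, since the full segment that replaces an arrow has the same degree as the
    arrow. *)
Definition sub_rep_def : gmx A B (fun _ : vertex Q => 0%N).
Proof.
apply: (@rep_gmx k Q B (fun v => pvertex k (sub_vtx v)) (fun a => segment a (deg a))).
- by move=> v; apply: pvertexK.
- by move=> a; apply: segment_src.
- by move=> v; apply: pvertex_comp.
by move=> a; exists (deg a); first exact: segment_comp.
Defined.

(** Interior vertices are slid back to the source of their arrow, so that only the last piece
    carries the arrow. *)
Definition contract_arrow (b : arrow S) : A :=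
  if (piece_idx b).+1 == deg (piece_of b) then parrow k (piece_of b)
  else pvertex k (src (piece_of b)).

Lemma sub_base_src (b : arrow S) : sub_base (src b) = src (piece_of b).
Proof. exact: sub_base_pos (piece_idx_lt b). Qed.

Lemma sub_depth_src (b : arrow S) : sub_depth (src b) = piece_idx b.
Proof. exact: sub_depth_pos (piece_idx_lt b). Qed.

Variant piece_spec (b : arrow S) : bool -> vertex S -> Prop :=
| LastPiece of (piece_idx b).+1 = deg (piece_of b) :
    piece_spec b true (sub_vtx (tgt (piece_of b)))
| InnerPiece of ((piece_idx b).+1 < deg (piece_of b))%N :
    piece_spec b false (sub_pos (piece_of b) (piece_idx b).+1).

Lemma pieceP (b : arrow S) :
  piece_spec b ((piece_idx b).+1 == deg (piece_of b)) (tgt b).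
Proof.
change (tgt b) with (sub_pos (piece_of b) (piece_idx b).+1); case: eqP => [e|ne].
  by rewrite e sub_pos_deg; apply: LastPiece.
by apply: InnerPiece; have := piece_idx_lt b; lia.
Qed.

Lemma contract_arrow_src b :
  pvertex k (src (piece_of b)) * contract_arrow b = contract_arrow b.
Proof. by rewrite /contract_arrow; case: ifP; rewrite ?pvertex_arrow ?eqxx ?pvertexK. Qed.

Lemma contract_arrow_tgt b :
  contract_arrow b * pvertex k (sub_base (tgt b)) = contract_arrow b.
Proof.
rewrite /contract_arrow; case: pieceP => [_|bi]; first by rewrite arrow_pvertex eqxx.
by rewrite sub_base_pos ?pvertexK.
Qed.

(** With the depth as offset the degrees balance: an inner piece of degree 0 raises the depth by 1,
    and the last piece of [a] has degree [deg a] and starts at depth [deg a - 1]. *)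
Definition contract_rep_def : gmx B A (fun v : vertex S => sub_depth v).
Proof.
apply: (@rep_gmx k S A (fun v => pvertex k (sub_base v)) contract_arrow).
- by move=> v; apply: pvertexK.
- by move=> b; rewrite sub_base_src contract_arrow_src.
- by move=> v; apply: pvertex_comp.
move=> b; rewrite sub_depth_src /contract_arrow; case: pieceP => [e|bi].
  by exists (deg (piece_of b)); [apply: parrow_comp | rewrite -e /=; lia].
by exists 0%N; [apply: pvertex_comp | rewrite sub_depth_pos //=; lia].
Defined.


Definition sub_rep := locked sub_rep_def.
Definition contract_rep := locked contract_rep_def.

Local Notation phi := sub_rep.
Local Notation theta := contract_rep.

Lemma sub_rep_in v w c x : phi v w (galg_in A c * x) = galg_in B c * phi v w x.
Proof. rewrite /sub_rep -lock; exact: rep_in. Qed.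

Lemma contract_rep_in v w c x : theta v w (galg_in B c * x) = galg_in A c * theta v w x.
Proof. rewrite /contract_rep -lock; exact: rep_in. Qed.

Lemma sub_rep_vertex v w u :
  phi v w (pvertex k u) = if (u == v) && (u == w) then pvertex k (sub_vtx u) else 0.
Proof. rewrite /sub_rep -lock; exact: rep_pvertex. Qed.

Lemma sub_rep_arrow v w a :
  phi v w (parrow k a) = if (src a == v) && (tgt a == w) then segment a (deg a) else 0.
Proof.
by rewrite /sub_rep -lock; apply: rep_parrow => b; apply: segment_end.
Qed.

Lemma contract_rep_vertex v w u :
  theta v w (pvertex k u) = if (u == v) && (u == w) then pvertex k (sub_base u) else 0.
Proof. rewrite /contract_rep -lock; exact: rep_pvertex. Qed.

Lemma contract_rep_arrow v w b :
  theta v w (parrow k b) = if (src b == v) && (tgt b == w) then contract_arrow b else 0.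
Proof. by rewrite /contract_rep -lock; apply: rep_parrow => {}b; apply: contract_arrow_tgt. Qed.

Lemma contract_segment a i v w : (i <= deg a)%N ->
  theta v w (segment a i) =
  if (sub_vtx (src a) == v) && (sub_pos a i == w)
  then (if i == deg a then parrow k a else pvertex k (src a)) else 0.
Proof.
elim: i w => [|i IHi] w ia.
  by rewrite contract_rep_vertex (ltn_eqF (deg_gt0 a)).
rewrite (segmentS ia) gmxM (bigD1 (sub_pos a i)) //= big1 ?addr0 => [|z /negPf zi].
  rewrite contract_rep_arrow IHi ?(ltnW ia) // eqxx andbT (ltn_eqF ia) /=.
  case: (_ == v); last by rewrite mul0r.
  rewrite ?eqxx /=; case: (_ == w); last by rewrite mulr0.
  exact: (contract_arrow_src (piece ia)).
by rewrite contract_rep_arrow /= eq_sym zi mulr0.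
Qed.

(** Contracting a full segment gives back the arrow, so contraction after subdivision yields the
    Peirce components of [x]. *)
Lemma contract_sub v v' w w' x :
  theta v v' (phi w w' x) =
  if (v == sub_vtx w) && (v' == sub_vtx w') then pvertex k w * x * pvertex k w' else 0.
Proof.
elim/pathAlg_gen: x v v' w w' => [x y IHx IHy|c x IHx|x y IHx IHy|u|a|] v v' w w'.
- rewrite !raddfD /= IHx IHy mulrDr mulrDl.
  by case: ifP => _; rewrite ?addr0.
- rewrite sub_rep_in contract_rep_in IHx; case: ifP => _; last by rewrite mulr0.
  by rewrite !mulrA galg_inC.
- rewrite PT_M; under eq_bigr => u _ do under eq_bigr => z _ do rewrite IHx IHy.
  under eq_bigr => u _.
    rewrite (bigD1 (sub_vtx u)) //= big1 ?addr0; last first.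
      by move=> z /negPf ->; rewrite andbF mul0r.
    rewrite eqxx andbT /=.
  over.
  case: (v == _) => /=; last by rewrite big1 // => u _; rewrite mul0r.
  case: (v' == _); last by rewrite big1 // => u _; rewrite mulr0.
  (* The sum over [u] is the decomposition of 1 into vertex idempotents, inserted between [x] and
     [y]. *)
  transitivity (pvertex k w * x * (\sum_u pvertex k u) * y * pvertex k w'); last first.
    by rewrite sum_pvertex mulr1 !mulrA.
  rewrite mulr_sumr !mulr_suml; apply: eq_bigr => u _.
  by rewrite !mulrA -(mulrA _ (pvertex k u) (pvertex k u)) pvertexK.
- rewrite sub_rep_vertex; have [<-|uw] /= := eqVneq u w; last first.
    by rewrite raddf0 pvertexM [w == u]eq_sym (negPf uw) mul0r if_same.
  rewrite pvertexK pvertexM; case: eqP => [<-|_]; last by rewrite raddf0 if_same.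
  by rewrite contract_rep_vertex ![sub_vtx u == _]eq_sym.
- rewrite sub_rep_arrow pvertex_arrow [w == _]eq_sym; case: eqP => [<-|_] /=; last first.
    by rewrite raddf0 mul0r if_same.
  rewrite arrow_pvertex [w' == _]eq_sym; case: eqP => [<-|_]; last by rewrite raddf0 if_same.
  by rewrite contract_segment // eqxx sub_pos_deg ![_ == v]eq_sym ![_ == v']eq_sym.
by rewrite !raddf0 mulr0 mul0r if_same.
Qed.

End SubdivisionMaps.

(** * The columns of the two comparison maps *)

Section SubdivisionColumns.
Variables (k : fieldType) (Q : wquiver).
Local Notation S := (subdivision Q).
Local Notation A := (pathAlg k Q).
Local Notation B := (pathAlg k (subdivision Q)).
Local Notation phi := (sub_rep k Q).
Local Notation theta := (contract_rep k Q).

Definition sub_col (w : vertex Q) (v : vertex S) : A :=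
  if v == sub_vtx w then pvertex k w else 0.

Lemma sub_col_comp w v : galg_comp (0 + sub_depth v) (sub_col w v).
Proof.
rewrite /sub_col; case: eqP => [->|_]; first exact: pvertex_comp.
exact: (grading0 (galg_grading A)).
Qed.

Lemma contract_sub_col x w v :
  \sum_w' \sum_v' theta v v' (phi w w' x) * sub_col w' v' = sub_col w v * x.
Proof.
transitivity (\sum_w' sub_col w v * x * pvertex k w'); last first.
  by rewrite -mulr_sumr sum_pvertex mulr1.
apply: eq_bigr => w' _; rewrite (bigD1 (sub_vtx w')) //= big1 ?addr0.
  rewrite contract_sub /sub_col !eqxx andbT; case: ifP => _; rewrite ?mul0r //.
  by rewrite -(mulrA _ (pvertex k w')) pvertexK.
by move=> v' /negPf v'w'; rewrite /sub_col v'w' mulr0.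
Qed.

(** Splitting elements form a two-sided ideal, so it suffices to split 1, the sum of the vertex
    idempotents. *)
Lemma sub_col_splits x : col_splits theta phi sub_col x.
Proof.
rewrite -[x]mul1r -sum_pvertex; apply: col_splitsMr; first exact: contract_sub_col.
apply: (big_ind (col_splits theta phi sub_col)) => [|y z|z _].
- exact: col_splits0.
- exact: col_splitsD.
split.
  exists (fun w' v' => if (w' == z) && (v' == sub_vtx w') then pvertex k z else 0).
  move=> w v w' v'; rewrite contract_sub /sub_col.
  case: (v == _); last by rewrite mul0r.
  case: (v' == _); last by rewrite !andbF mulr0.
  by rewrite -mulrA pvertexM eq_sym andbT /=; case: eqP => [->|].
exists (fun w v => if (w == z) && (v == sub_vtx w) then pvertex k z else 0).
rewrite (bigD1 z) //= [X in _ + X]big1 ?addr0 => [|w /negPf ->]; last first.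
  by rewrite big1 // => v _; rewrite mul0r.
rewrite (bigD1 (sub_vtx z)) //= big1 ?addr0 => [|v /negPf ->]; last first.
  by rewrite andbF mul0r.
by rewrite /sub_col !eqxx pvertexK.
Qed.

(** The path that leads to [v] from its base vertex in [Q], trivial if [v] is itself a vertex of
    [Q]. *)
Definition stem (v : vertex S) : B :=
  match v with
  | inl v => pvertex k (sub_vtx v)
  | inr o => segment k (tag o) (tagged o).+1
  end.

Lemma stem_pos a i : (i < deg a)%N -> stem (sub_pos a i) = segment k a i.
Proof.
by case: i => // i ia; have h : (i < (deg a).-1)%N by [lia]; rewrite (sub_posS h).
Qed.

Lemma stem_pvertex v : stem v * pvertex k v = stem v.
Proof.
case: v => [v|[a o]]; first exact: pvertexK.
have oa : (o.+1 <= deg a)%N by have := ltn_ord o; lia.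
have := segment_tgt k oa; rewrite (sub_posS (ltn_ord o)).
by rewrite [Ordinal _](_ : _ = o) //; apply: val_inj.
Qed.

Lemma stem_comp v : galg_comp (sub_depth v) (stem v).
Proof.
case: v => [v|[a o]]; first exact: pvertex_comp.
by apply: segment_comp; have := ltn_ord o; rewrite /=; lia.
Qed.

(** Appending [b] to the stem of its source gives the next stem if [b] is an inner piece, and the
    full segment, which is the subdivided arrow, if [b] is the last one. *)
Lemma contract_arrow_stem w (b : arrow S) :
  phi w (sub_base (tgt b)) (contract_arrow k b) * stem (tgt b) =
  if w == sub_base (src b) then stem (src b) * parrow k b else 0.
Proof.
rewrite sub_base_src [stem (src b)](stem_pos (piece_idx_lt b)).
have -> : segment k (piece_of b) (piece_idx b) * parrow k b =
          segment k (piece_of b) (piece_idx b).+1.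
  rewrite (segmentS k (piece_idx_lt b)); congr (_ * parrow k _).
  by case: b => a [i ia]; congr Tagged; apply: val_inj.
rewrite /contract_arrow; case: pieceP => [e|bi].
  rewrite sub_rep_arrow eqxx andbT [w == _]eq_sym e; case: ifP => _; last by rewrite mul0r.
  exact: segment_end.
rewrite sub_base_pos // sub_rep_vertex eqxx andbT [w == _]eq_sym stem_pos //.
by case: ifP => _; rewrite ?mul0r // segment_src.
Qed.

Definition stem_col (v : vertex S) (w : vertex Q) : B :=
  if w == sub_base v then stem v else 0.

Lemma stem_col_comp v w : galg_comp (sub_depth v + 0) (stem_col v w).
Proof.
rewrite /stem_col addn0; case: eqP => [_|_]; first exact: stem_comp.
exact: (grading0 (galg_grading B)).
Qed.

Lemma sum_stem_col v w x :
  \sum_v' \sum_w' phi w w' (theta v v' x) * stem_col v' w' =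
  \sum_v' phi w (sub_base v') (theta v v' x) * stem v'.
Proof.
apply: eq_bigr => v' _; rewrite (bigD1 (sub_base v')) //= big1 ?addr0.
  by rewrite /stem_col eqxx.
by move=> w' /negPf w'v'; rewrite /stem_col w'v' mulr0.
Qed.

(** Both sides are compatible with sums, scalars and products, so vertices and arrows suffice; the
    case of arrows is [contract_arrow_stem]. *)
Lemma sub_contract_col x v w :
  \sum_v' \sum_w' phi w w' (theta v v' x) * stem_col v' w' = stem_col v w * x.
Proof.
rewrite sum_stem_col.
elim/pathAlg_gen: x v w => [x y IHx IHy|c x IHx|x y IHx IHy|u|b|] v w.
- rewrite mulrDr -IHx -IHy -big_split; apply: eq_bigr => v' _.
  by rewrite !raddfD mulrDl.
- transitivity (galg_in B c * (stem_col v w * x)).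
    rewrite -IHx mulr_sumr; apply: eq_bigr => v' _.
    by rewrite contract_rep_in sub_rep_in mulrA.
  by rewrite !mulrA galg_inC.
- rewrite mulrA -IHx mulr_suml.
  under eq_bigr => v' _ do rewrite PT_M mulr_suml.
  rewrite exchange_big; apply: eq_bigr => z _ /=.
  under eq_bigr => v' _ do rewrite mulr_suml.
  rewrite exchange_big (bigD1 (sub_base z)) //= [X in _ + X]big1 ?addr0.
    under eq_bigr => v' _ do rewrite -mulrA.
    by rewrite -mulr_sumr IHy /stem_col eqxx mulrA.
  move=> r /negPf rz; under eq_bigr => v' _ do rewrite -mulrA.
  by rewrite -mulr_sumr IHy /stem_col rz mul0r mulr0.
- rewrite (bigD1 u) //= big1 ?addr0 => [|v' /negPf v'u]; last first.
    by rewrite contract_rep_vertex [u == v']eq_sym v'u andbF raddf0 mul0r.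
  rewrite contract_rep_vertex eqxx andbT /stem_col.
  have [->|uv] := eqVneq u v; last first.
    rewrite raddf0 mul0r; case: ifP => _; last by rewrite mul0r.
    by rewrite -stem_pvertex -mulrA pvertexM [v == u]eq_sym (negPf uv) mulr0.
  rewrite sub_rep_vertex eqxx andbT [w == _]eq_sym.
  case: ifP => _; last by rewrite !mul0r.
  rewrite stem_pvertex; case: (v) => [z|[a o]]; first exact: pvertexK.
  exact: segment_src.
- rewrite (bigD1 (tgt b)) //= big1 ?addr0 => [|v' /negPf v'b]; last first.
    by rewrite contract_rep_arrow [tgt b == v']eq_sym v'b andbF raddf0 mul0r.
  rewrite contract_rep_arrow eqxx andbT.
  have [<-|bv] := eqVneq (src b) v; last first.
    rewrite raddf0 mul0r /stem_col; case: ifP => _; last by rewrite mul0r.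
    by rewrite -stem_pvertex -mulrA pvertex_arrow [v == _]eq_sym (negPf bv) mulr0.
  by rewrite contract_arrow_stem /stem_col; case: ifP => _; rewrite ?mul0r.
by rewrite mulr0 big1 // => v' _; rewrite !raddf0 mul0r.
Qed.

Lemma stem_col_splits_vertex z : col_splits phi theta stem_col (pvertex k (sub_vtx z)).
Proof.
split.
  exists (fun v' w' => if (v' == sub_vtx z) && (w' == z) then pvertex k (sub_vtx z) else 0).
  move=> v w v' w'; rewrite contract_rep_vertex [v' == _]eq_sym.
  have [_|zv'] /= := eqVneq (sub_vtx z) v'; last by rewrite andbF raddf0 mulr0.
  have [->|w'z] := eqVneq w' z; last first.
    case: ifP => _; rewrite ?raddf0 ?mulr0 // sub_rep_vertex /=.
    by rewrite [z == w']eq_sym (negPf w'z) andbF.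
  rewrite andbT /stem_col; have [<-|zv] := eqVneq (sub_vtx z) v.
    rewrite sub_rep_vertex eqxx andbT [w == _]eq_sym.
    by case: ifP => _; rewrite ?mul0r //= pvertexK.
  rewrite raddf0; case: ifP => _; rewrite ?mul0r //.
  by rewrite -stem_pvertex -mulrA pvertexM [v == _]eq_sym (negPf zv) mulr0.
exists (fun v w => if (v == sub_vtx z) && (w == z) then pvertex k (sub_vtx z) else 0).
rewrite (bigD1 (sub_vtx z)) //= [X in _ + X]big1 ?addr0 => [|v /negPf ->]; last first.
  by rewrite big1 // => w _; rewrite mul0r.
rewrite (bigD1 z) //= big1 ?addr0 => [|w /negPf ->]; last by rewrite andbF mul0r.
by rewrite /stem_col !eqxx /= pvertexK.
Qed.

(** So long a path meets a vertex [z] of [Q], hence lies in the two-sided ideal generated by the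
    idempotent of [z], which splits. *)
Lemma stem_col_splits_path (p : qpath S) :
  (\max_(a : arrow Q) deg a <= path_deg p)%N -> col_splits phi theta stem_col (pgen k p).
Proof.
have degE : path_deg p = size (path_arrows p).
  by rewrite /path_deg sum1_size.
rewrite degE; case: p {degE} => [[v s] /= h]; rewrite /path_arrows /= => ps.
have [s1 [s2 [z [sE lz]]]] : exists s1 s2 z, s = s1 ++ s2 /\
    last v (map (@tgt S) s1) = sub_vtx z.
  case: v h => [v|[a o]] h; first by exists [::], s, v.
  have oa : (o.+1 <= deg a)%N by have := ltn_ord o; lia.
  have ov : inr (Tagged (fun a => 'I_(deg a).-1) o) = sub_pos a o.+1.
    by rewrite (sub_posS (ltn_ord o)); congr (inr (Tagged _ _)); apply: val_inj.
  (* From an interior vertex of [a], the target of [a] is at most [deg a] steps away, and the path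
     is at least that long. *)
  move: h ov => /[swap] ->; move=> h; apply: (sub_path_split oa (leqnn _) h).
  by apply: leq_trans ps; apply: leq_trans (leq_bigmax a); apply: leq_subr.
move: h; rewrite sE => h; have := h; rewrite composable_cat => /andP[h1 h2].
rewrite (pgen_cat k h h1 h2).
have -> : pgen k (@QPath S (v, s1) h1) =
    pgen k (@QPath S (v, s1) h1) * pvertex k (sub_vtx z).
  by rewrite pgen_pvertex -lz eqxx.
apply: (col_splitsMr sub_contract_col); apply: (col_splitsMl sub_contract_col).
exact: stem_col_splits_vertex.
Qed.

Lemma stem_col_splits m x : (\max_(a : arrow Q) deg a <= m)%N -> galg_comp m x ->
  col_splits phi theta stem_col x.
Proof.
move=> Dm xm; rewrite (monalgE (x : pathRing k S)) big_seq.
apply: (big_ind (col_splits phi theta stem_col)) => [|y z|p px].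
- exact: col_splits0.
- exact: col_splitsD.
have -> : (<< (x : pathRing k S)@_p *g p >> : B) =
    galg_in B (x : pathRing k S)@_p * pgen k p.
  by rewrite pgenE galg_in_scale scale_monom mulr1.
apply: (col_splitsMl sub_contract_col); apply: stem_col_splits_path.
by rewrite (xm p px).
Qed.

End SubdivisionColumns.

(** * Equivalence of the quotient categories *)

Section Ideals.

Lemma idealD (R : pzRingType) (I : ideal R) x y : I x -> I y -> I (x + y).
Proof.
move=> Ix Iy; rewrite -[y]opprK -[- y]sub0r.
by do 2!apply: idealB => //; apply: ideal0.
Qed.

Lemma ideal_sum (R : pzRingType) (I : ideal R) (T : Type) (s : seq T)
  (P : pred T) (F : T -> R) :
  (forall i, P i -> I (F i)) -> I (\sum_(i <- s | P i) F i).
Proof.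
by move=> IF; apply: big_ind => //; [apply: ideal0 | apply: idealD].
Qed.

Definition ideal_gen (R : pzRingType) (s : seq R) : ideal R.
Proof.
exists (fun x => forall J : ideal R, (forall y, y \in s -> J y) -> J x).
- by move=> J _; apply: ideal0.
- by move=> x y Jx Jy J sJ; apply: idealB; [apply: Jx | apply: Jy].
- by move=> a x Jx J sJ; apply: idealMl; apply: Jx.
by move=> a x Jx J sJ; apply: idealMr; apply: Jx.
Defined.

Lemma mem_ideal_gen (R : pzRingType) (s : seq R) y : y \in s -> ideal_gen s y.
Proof. by move=> ys J; apply. Qed.

Lemma ideal_gen_fg (R : pzRingType) (s : seq R) : finitely_generated (ideal_gen s).
Proof. by exists s. Qed.

(** An ideal because entries of a product are sums of products of entries; through it, inclusions
    along [t] are tested on generators. *)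
Definition gmx_preim (k : fieldType) (A B : gradedAlg k) (V : finType)
  (off : V -> nat) (t : gmx A B off) (K : ideal B) : ideal A.
Proof.
exists (fun x => forall v w, K (t v w x)).
- by move=> v w; rewrite raddf0; apply: ideal0.
- by move=> x y Kx Ky v w; rewrite raddfB; apply: idealB; [apply: Kx | apply: Ky].
- by move=> a x Kx v w; rewrite gmxM; apply: ideal_sum => u _; apply: idealMl; apply: Kx.
by move=> a x Kx v w; rewrite gmxM; apply: ideal_sum => u _; apply: idealMr; apply: Kx.
Defined.

Section Homogeneous.
Variables (k : fieldType) (A : gradedAlg k) (K : ideal A).
Local Notation gA := (galg_grading A).


Lemma ideal_gprojM n a x :
  (forall i j, K (gproj gA i a * gproj gA j x)) -> K (gproj gA n (a * x)).
Proof.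
move=> Kax; rewrite -[a in a * x](gproj_sum (gsupp_uniq gA a) (fun _ e => e)).
rewrite -[x in _ * x](gproj_sum (gsupp_uniq gA x) (fun _ e => e)).
rewrite mulr_suml raddf_sum; apply: ideal_sum => i _ /=.
rewrite mulr_sumr raddf_sum; apply: ideal_sum => j _ /=.
have ax := galg_compM (gprojP gA i a) (gprojP gA j x).
have [->|nij] := eqVneq n (i + j)%N; first by rewrite gproj_id.
by rewrite (gproj_neq _ ax nij); apply: ideal0.
Qed.

(** The largest homogeneous ideal inside [K]; a generated ideal is homogeneous once its generators
    lie in its own homogeneous part. *)
Definition homogeneous_part : ideal A.
Proof.
exists (fun x => forall n, K (gproj gA n x)).
- by move=> n; rewrite raddf0; apply: ideal0.
- by move=> x y Kx Ky n; rewrite raddfB; apply: idealB; [apply: Kx | apply: Ky].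
- by move=> a x Kx n; apply: ideal_gprojM => i j; apply: idealMl; apply: Kx.
by move=> a x Kx n; apply: ideal_gprojM => i j; apply: idealMr; apply: Kx.
Defined.

End Homogeneous.

Lemma ideal_gen_homogeneous (k : fieldType) (A : gradedAlg k) (s : seq A) :
  (forall y n, y \in s -> ideal_gen s (gproj (galg_grading A) n y)) ->
  homogeneous_ideal (ideal_gen s).
Proof.
move=> sh; apply: (gproj_homogeneous (gC := galg_grading A)) => n x.
by move=> /(_ (homogeneous_part (ideal_gen s))); apply=> y ys m; apply: sh.
Qed.

End Ideals.

(** * Induced functors on the quotient categories *)

Section Equivalence.
Variables (k : fieldType) (A B : gradedAlg k).
Hypotheses (fA : degreewise_finite A) (fB : degreewise_finite B).

Lemma transfer_Fdim_iso (V : finType) (off : V -> nat) (t : gmx B A off)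
    (M N : Gr A) (f : hom M N) :
  Fdim_iso f -> Fdim_iso (fhom (transfer_functor t) f).
Proof.
by move/(Fdim_isoP f fA)/(transfer_torsion_iso t); apply: (proj2 (Fdim_isoP _ fB)).
Qed.

Definition transfer_QGr (V : finType) (off : V -> nat) (t : gmx B A off) :
    functor (QGr A) (QGr B) :=
  loc_functor (@transfer_Fdim_iso V off t).

Lemma transfer_QGr_shift (V : finType) (off : V -> nat) (t : gmx B A off) (M : QGr A) :
  isomorphic (transfer_QGr t (QGr_shift M)) (QGr_shift (transfer_QGr t M)).
Proof.
exists (Lof (@Fdim_iso k B) (transfer_shift t M : @hom (Gr B) _ _)).
by apply: (@loc_iso_of (Gr B) _ _ _ _ (transfer_unshift t M)) => x.
Qed.

End Equivalence.

Lemma counit_nat_isomorphic (k : fieldType) (A B : gradedAlg k)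
    (fA : degreewise_finite A) (fB : degreewise_finite B)
    (V W : finType) (offV : V -> nat) (offW : W -> nat)
    (P : gmx B A offV) (T : gmx A B offW) (u : W -> V -> A) D :
    (forall w v, galg_comp (offW w + offV v) (u w v)) ->
    (forall x w v, \sum_w' \sum_v' P v v' (T w w' x) * u w' v' = u w v * x) ->
    (forall m x, (D <= m)%N -> galg_comp m x -> col_splits P T u x) ->
  nat_isomorphic (functor_comp (transfer_QGr fA fB P) (transfer_QGr fB fA T))
    (functor_id (QGr A)).
Proof.
move=> u_comp PTu uD.
have := @loc_nat_isomorphic (Gr A) (Gr B) (@Fdim_iso k A) (@Fdim_iso k B)
  (transfer_functor P) (transfer_functor T)
  (@transfer_Fdim_iso _ _ _ fA fB _ _ P) (@transfer_Fdim_iso _ _ _ fB fA _ _ T)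
  (counit u_comp PTu).
apply.
  by move=> M N f m; apply: counit_natural.
by move=> M; apply/(Fdim_isoP _ fA); apply: counit_torsion_iso uD.
Qed.

Theorem theorem1p1 (k : fieldType) (Q : wquiver) (I : ideal (pathAlg k Q))
    (fgI : finitely_generated I) (homI : homogeneous_ideal I) :
  exists (Q' : wquiver) (I' : ideal (pathAlg k Q'))
    (homI' : homogeneous_ideal I')
    (F : functor (QGr (quotAlg homI)) (QGr (quotAlg homI'))),
    [/\ forall a : arrow Q', deg a = 1%N,
        finitely_generated I',
        is_equivalence F
      & forall M : QGr (quotAlg homI),
          isomorphic (F (QGr_shift M)) (QGr_shift (F M))].
Proof.
have [s sI] := fgI.
pose phi := sub_rep k Q; pose theta := contract_rep k Q.
(* All matrix entries of the subdivided generators: finitely many, as [Q] has finitely many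
   vertices. *)
pose s' := [seq phi vw.1 vw.2 y | y <- s, vw <- enum {: vertex Q * vertex Q}].
pose I' := ideal_gen s'.
have phiI v w x : I x -> I' (phi v w x).
  move=> /sI/(_ (gmx_preim phi I')); apply=> y ys {}v {}w.
  apply: mem_ideal_gen; apply/allpairsP; exists (y, (v, w)); split=> //=.
  by rewrite mem_enum.
(* By [contract_sub], a generator [phi a b y] goes to 0 or to the Peirce component of [y] at [a] and
   [b], which stays in [I]. *)
have thetaI v w x : I' x -> I (theta v w x).
  move=> /(_ (gmx_preim theta I)); apply=> _ /allpairsP[[y [a b]] /= [ys _ ->]] {}v {}w.
  rewrite contract_sub; case: ifP => _; last exact: ideal0.
  by apply: idealMr; apply: idealMl; apply/sI => J; apply.
have homI' : homogeneous_ideal I'.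
  apply: ideal_gen_homogeneous => _ n /allpairsP[[y [a b]] /= [ys _ ->]].
  (* As the offsets of [phi] are 0, components of a generator are images of components of [y], which
     lie in [I] by [homI]. *)
  have phiC m x : galg_comp m x -> galg_comp m (phi a b x) by move/gmx_comp; apply.
  rewrite -(gproj_morph (galg_grading (pathAlg k Q)) _ (f := gmx_fun phi a b) phiC).
  apply: phiI; apply: homogeneous_gproj homI (ideal0 I) _ _ _.
  by apply/sI => J; apply.
have fA := quot_degreewise_finite homI (pathAlg_degreewise_finite k Q).
have fB := quot_degreewise_finite homI' (pathAlg_degreewise_finite k (subdivision Q)).
pose phiq := gmx_quot homI homI' phiI; pose thetaq := gmx_quot homI' homI thetaI.
(* Contraction induces the functor [M (x) e A']; subdivision induces its quasi-inverse [N e]. *)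
exists (subdivision Q), I', homI', (transfer_QGr fA fB thetaq).
split=> //; first exact: ideal_gen_fg.
  exists (transfer_QGr fB fA phiq); split.
    (* The bound is 0 because every element splits here. *)
    apply: (@counit_nat_isomorphic _ _ _ fA fB _ _ _ _ thetaq phiq
      (fun w v => iproj I (sub_col k w v)) 0).
    - exact/u_quot_comp/sub_col_comp.
    - exact/PTu_quot/contract_sub_col.
    move=> m x _ _; have [{}x ->] := iproj_surj x.
    exact/col_splits_quot/sub_col_splits.
  (* Here splitting starts at the length of the longest subdivided arrow, from which on every path
     meets a vertex of [Q]. *)
  apply: (@counit_nat_isomorphic _ _ _ fB fA _ _ _ _ phiq thetaq
    (fun v w => iproj I' (stem_col k v w)) (\max_(a : arrow Q) deg a)).
  - exact/u_quot_comp/stem_col_comp.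
  - exact/PTu_quot/sub_contract_col.
  move=> m _ Dm [x xm ->]; apply: col_splits_quot.
  exact: stem_col_splits Dm xm.
by move=> M; apply: transfer_QGr_shift.
Qed.
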